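(* Let $(X,\mathcal{O}_X)$ be a special topological ringed space and let $(\mathcal{L},[\cdot,\cdot]_{\mathcal{L}},\mathfrak{a}_{\mathcal{L}})$ be a Lie algebroid over $(X,\mathcal{O}_X)$ which is locally free of finite rank as an $\mathcal{O}_X$-module. Let $\mathcal{E}$ be a locally free $\mathcal{O}_X$-module of finite rank. Then $\mathcal{E}$ has an $\mathcal{L}$-Lie algebroid structure if and only if $\Omega^\bullet_{\mathcal{E}}:=(\wedge^\bullet_{\mathcal{O}_X}\mathcal{E}^*,{\rm d}_{\mathcal{E}})$ has an $\Omega^\bullet_{\mathcal{L}}$-differential graded algebra structure (that is, there is a differential ${\rm d}_{\mathcal{E}}$ on the exterior algebra $\wedge^\bullet_{\mathcal{O}_X}\mathcal{E}^*$ for which $(\wedge^\bullet_{\mathcal{O}_X}\mathcal{E}^*,{\rm d}_{\mathcal{E}})$ is an $\Omega^\bullet_{\mathcal{L}}$-differential graded algebra).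
   Context: $\mathbb{K}$ is $\mathbb{R}$, $\mathbb{C}$, or an algebraically closed field of characteristic $0$; $\mathbb{K}_X$ is the constant sheaf. A topological ringed space $(X,\mathcal{O}_X)$ is a topological space $X$ with a $\mathbb{K}_X$-subalgebra $\mathcal{O}_X$ of the sheaf of continuous $\mathbb{K}$-valued functions ($\mathbb{K}$ with Euclidean or Zariski topology). It is called special if it is a smooth manifold, complex manifold, analytic space or algebraic variety with its usual structure sheaf. $\mathcal{T}_X=\mathcal{D}er_{\mathbb{K}_X}(\mathcal{O}_X)$ is the sheaf of derivations with commutator bracket, $\Omega^1_X=\mathcal{T}_X^*=\mathcal{H}om_{\mathcal{O}_X}(\mathcal{T}_X,\mathcal{O}_X)$, and ${\rm d}_X:\mathcal{O}_X\to\Omega^1_X$ is ${\rm d}_Xf(D)=D(f)$. For an $\mathcal{O}_X$-module $\mathcal{F}$, $\mathcal{F}^*=\mathcal{H}om_{\mathcal{O}_X}(\mathcal{F},\mathcal{O}_X)$. A Lie algebroid $(\mathcal{L},[\cdot,\cdot]_{\mathcal{L}},\mathfrak{a}_{\mathcal{L}})$ over $(X,\mathcal{O}_X)$ is an $\mathcal{O}_X$-module that is also a sheaf of $\mathbb{K}$-Lie algebras, with an anchor $\mathfrak{a}_{\mathcal{L}}:\mathcal{L}\to\mathcal{T}_X$ that is $\mathcal{O}_X$-linear and a $\mathbb{K}_X$-Lie algebra homomorphism, satisfying $[D,fD']=f[D,D']+\mathfrak{a}_{\mathcal{L}}(D)(f)D'$. Morphisms of Lie algebroids are $\mathcal{O}_X$-linear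 Lie algebra homomorphisms commuting with anchors. An $\mathcal{L}$-Lie algebroid structure on an $\mathcal{O}_X$-module $\mathcal{E}$ is a Lie algebroid structure on $\mathcal{E}$ together with a Lie algebroid morphism $\phi:\mathcal{E}\to\mathcal{L}$. A differential graded algebra $\mathcal{A}^\bullet=(\bigoplus_{i\ge0}\mathcal{A}^i,\wedge,{\rm d}_{\mathcal{A}})$ over $(X,\mathcal{O}_X)$ is a graded commutative $\mathcal{O}_X$-algebra (here $\mathcal{A}^0=\mathcal{O}_X$) with a $\mathbb{K}_X$-linear map ${\rm d}_{\mathcal{A}}$ of degree $1$, ${\rm d}_{\mathcal{A}}^2=0$, satisfying the graded Leibniz rule; a homomorphism is a graded $\mathcal{O}_X$-algebra map commuting with the differentials. $\Omega^\bullet_{\mathcal{L}}=(\wedge^\bullet_{\mathcal{O}_X}\mathcal{L}^*,{\rm d}_{\mathcal{L}})$ is the Chevalley–Eilenberg–de Rham differential graded algebra, with $${\rm d}_{\mathcal{L}}\omega(D_1\wedge\cdots\wedge D_{k+1})=\sum_i(-1)^{i+1}\mathfrak{a}_{\mathcal{L}}(D_i)(\omega(D_1\wedge\cdots\widehat{D_i}\cdots\wedge D_{k+1}))+\sum_{i<j}(-1)^{i+j}\omega([D_i,D_j]\wedge D_1\wedge\cdots\widehat{D_i}\cdots\widehat{D_j}\cdots\wedge D_{k+1}).$$ An $\Omega^\bullet_{\mathcal{L}}$-differential graded algebra is a differential graded algebra $\mathcal{A}^\bullet$ over $(X,\mathcal{O}_X)$ together with a differential graded algebra homomorphism $\psi:\Omega^\bullet_{\mathcal{L}}\to\mathcal{A}^\bullet$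 such that ${\rm d}_{\mathcal{A}}$ on $\mathcal{O}_X$ is the composition $\mathcal{O}_X\xrightarrow{{\rm d}_X}\Omega^1_X\xrightarrow{\mathfrak{a}_{\mathcal{L}}^*}\Omega^1_{\mathcal{L}}=\mathcal{L}^*\xrightarrow{\psi_1}\mathcal{A}^1$, where $\mathfrak{a}_{\mathcal{L}}^*$ is the dual of the anchor and $\psi_1$ is the restriction of $\psi$ to $\Omega^1_{\mathcal{L}}$. *)

(* Defs.v *)
From HB Require Import structures.
From mathcomp Require Import all_boot all_order all_algebra.
From mathcomp Require Import complex.
From mathcomp Require mpoly.
From mathcomp Require Import all_classical all_reals.
From mathcomp Require Import topology normedtype derive.
Import Order.TTheory GRing.Theory Num.Theory.
Import numFieldNormedType.Exports.

Set Implicit Arguments.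
Unset Strict Implicit.
Unset Printing Implicit Defensive.

Local Open Scope classical_set_scope.
Local Open Scope ring_scope.

Record opens (T : topologicalType) := Opens {
  oset :> set T;
  oopen : open oset }.

Definition opensI (T : topologicalType) (U V : opens T) : opens T :=
  Opens (openI (oopen U) (oopen V)).

Definition incl (T : Type) (U V : set T) (h : V `<=` U) (v : V) : U :=
  exist _ (val v) (mem_set (h _ (set_mem (valP v)))).

(* [KO] is the collection of open subsets of K: the Euclidean or the Zariski
   topology, see [special] below. *)
Record ringed_space (K : fieldType) (KO : set (set K)) := RingedSpace {
  rs_space :> topologicalType;
  regular : forall U : opens rs_space, set (U -> K);
  regular_continuous : forall (U : opens rs_space) (f : U -> K),
    regular f -> forall A, KO A ->
    open [set x | exists2 u : U, val u = x & A (f u)];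
  regular_cst : forall (U : opens rs_space) (c : K),
    regular (fun=> c : K) (U := U);
  regularB : forall (U : opens rs_space) (f g : U -> K),
    regular f -> regular g -> regular (f - g);
  regularM : forall (U : opens rs_space) (f g : U -> K),
    regular f -> regular g -> regular (f * g);
  regular_res : forall (U V : opens rs_space) (h : V `<=` U) (f : U -> K),
    regular f -> regular (f \o incl h);
  regular_glue : forall (U : opens rs_space) (f : U -> K),
    (forall u : U, exists (V : opens rs_space) (h : V `<=` U),
       oset V (val u) /\ regular (f \o incl h)) ->
    regular f }.
Arguments regular {K KO} X U _ : rename.

Section StructureSheaf.
Context {K : fieldType} {KO : set (set K)} (X : ringed_space KO).
Implicit Types U V W : opens X.

Definition regular_pred U : {pred (U -> K)} := fun f => f \in regular X U.
Arguments regular_pred : clear implicits.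

Lemma regular_subring U : subring_closed (regular_pred U).
Proof.
split=> [|f g|f g]; rewrite /regular_pred ?unfold_in.
- exact/mem_set/(regular_cst U 1).
- by move=> /set_mem rf /set_mem rg; apply/mem_set/regularB.
- by move=> /set_mem rf /set_mem rg; apply/mem_set/regularM.
Qed.

Record OX U := Osec { Oval :> U -> K; OvalP : regular_pred U Oval }.

HB.instance Definition _ U := [isSub for @Oval U].
HB.instance Definition _ U := [Choice of OX U by <:].
HB.instance Definition _ U :=
  GRing.SubChoice_isSubComPzRing.Build (U -> K) (regular_pred U) (OX U)
    (@regular_subring U).

Lemma O_ext U (f g : OX U) : (forall u, f u = g u) -> f = g.
Proof. by move=> fg; apply/val_inj/funext. Qed.

Definition Ocst U (c : K) : OX U := Osec (mem_set (regular_cst U c)).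

Definition Ores U V (h : V `<=` U) (f : OX U) : OX V :=
  Osec (mem_set (regular_res h (set_mem (OvalP f)))).

Lemma OresE U V (h : V `<=` U) (f : OX U) v : Ores h f v = f (incl h v).
Proof. by []. Qed.

Lemma OaddE U (f g : OX U) u : (f + g) u = f u + g u. Proof. by []. Qed.
Lemma OmulE U (f g : OX U) u : (f * g) u = f u * g u. Proof. by []. Qed.
Lemma OoneE U u : (1 : OX U) u = 1. Proof. by []. Qed.
Lemma OcstE U c u : Ocst U c u = c. Proof. by []. Qed.

Lemma Ores_id U (h : U `<=` U) (f : OX U) : Ores h f = f.
Proof. by apply: O_ext => u; rewrite OresE; congr (f _); apply: val_inj. Qed.

Lemma Ores_comp U V W (h : V `<=` U) (k : W `<=` V) (l : W `<=` U) (f : OX U) :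
  Ores k (Ores h f) = Ores l f.
Proof. by apply: O_ext => u; rewrite !OresE; congr (f _); apply: val_inj. Qed.

Lemma OresD U V (h : V `<=` U) (f g : OX U) :
  Ores h (f + g) = Ores h f + Ores h g.
Proof. exact: O_ext. Qed.

Lemma OresM U V (h : V `<=` U) (f g : OX U) :
  Ores h (f * g) = Ores h f * Ores h g.
Proof. exact: O_ext. Qed.

Lemma Ores1 U V (h : V `<=` U) : Ores h 1 = 1.
Proof. exact: O_ext. Qed.

Lemma Ores_cst U V (h : V `<=` U) c : Ores h (Ocst U c) = Ocst V c.
Proof. exact: O_ext. Qed.

Definition covers (U : opens X) (I : Type) (V : I -> opens X) :=
  forall x, oset U x -> exists i, oset (V i) x.

Lemma O_separated U (I : Type) (V : I -> opens X) (h : forall i, V i `<=` U)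
    (f g : OX U) :
  covers U V -> (forall i, Ores (h i) f = Ores (h i) g) -> f = g.
Proof.
move=> cov fg; apply: O_ext => u.
have [i ui] := cov _ (set_mem (valP u)).
have /(congr1 (fun f : OX _ => f (exist _ (val u) (mem_set ui)))) := fg i.
rewrite !OresE.
by have -> : incl (h i) (exist _ (val u) (mem_set ui)) = u by apply: val_inj.
Qed.

Lemma O_glue U (I : Type) (V : I -> opens X) (h : forall i, V i `<=` U)
    (f : forall i, OX (V i)) :
  covers U V ->
  (forall i j W (hi : W `<=` V i) (hj : W `<=` V j),
     Ores hi (f i) = Ores hj (f j)) ->
  exists g : OX U, forall i, Ores (h i) g = f i.
Proof.
move=> cov agree.
have /choice[idx idxP] : forall u : U, exists i, oset (V i) (val u).
  by move=> u; apply: cov; apply: set_mem (valP u).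
pose g (u : U) := f (idx u) (exist _ (val u) (mem_set (idxP u))).
have gE i (v : V i) : g (incl (h i) v) = f i v.
  set u := incl (h i) v.
  have vV : oset (V i) (val v) by apply: set_mem (valP v).
  have := agree (idx u) i (opensI (V (idx u)) (V i))
    (@subIsetl _ _ _) (@subIsetr _ _ _).
  move/(congr1 (fun f : OX _ => f (exist _ (val v) (mem_set (conj (idxP u) vV))))).
  rewrite !OresE /g => e; apply: etrans (etrans e _); congr (f _ _);
  exact: val_inj.
have gr : regular X U g.
  apply: regular_glue => u; exists (V (idx u)), (h (idx u)); split=> //.
  suff -> : g \o incl (h (idx u)) = f (idx u) by exact: set_mem (OvalP _).
  by apply/funext => v /=; rewrite gE.
exists (Osec (mem_set gr)) => i; apply: O_ext => v; rewrite OresE /=; exact: gE.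
Qed.

Record module_sheaf := ModuleSheaf {
  sec :> forall U : opens X, lmodType (OX U);
  res : forall U V : opens X, V `<=` U -> sec U -> sec V;
  res_linear : forall U V (h : V `<=` U) (f : OX U) (s t : sec U),
    res h (f *: s + t) = Ores h f *: res h s + res h t;
  res_id : forall U (h : U `<=` U) (s : sec U), res h s = s;
  res_comp : forall U V W (h : V `<=` U) (k : W `<=` V) (l : W `<=` U)
    (s : sec U), res k (res h s) = res l s;
  sheaf_separated : forall U (I : Type) (V : I -> opens X)
    (h : forall i, V i `<=` U) (s t : sec U), covers U V ->
    (forall i, res (h i) s = res (h i) t) -> s = t;
  sheaf_glue : forall U (I : Type) (V : I -> opens X)
    (h : forall i, V i `<=` U) (s : forall i, sec (V i)), covers U V ->
    (forall i j W (hi : W `<=` V i) (hj : W `<=` V j),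
       res hi (s i) = res hj (s j)) ->
    exists t : sec U, forall i, res (h i) t = s i }.

End StructureSheaf.

Section SheafTheory.
Context {K : fieldType} {KO : set (set K)} {X : ringed_space KO}.
Implicit Types (U V W : opens X) (F G : module_sheaf X).

Lemma resD F U V (h : V `<=` U) (s t : F U) : res h (s + t) = res h s + res h t.
Proof. by have := res_linear h 1 s t; rewrite Ores1 !scale1r. Qed.

Lemma res0 F U V (h : V `<=` U) : res h (0 : F U) = 0.
Proof.
by apply: (@addrI _ (res h (0 : F U))); rewrite -resD addr0 addr0.
Qed.

Lemma resZ F U V (h : V `<=` U) f (s : F U) :
  res h (f *: s) = Ores h f *: res h s.
Proof. by have := res_linear h f s 0; rewrite !addr0 res0 addr0. Qed.

Lemma resN F U V (h : V `<=` U) (s : F U) : res h (- s) = - res h s.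
Proof.
by apply: (@addrI _ (res h s)); rewrite -resD !subrr res0.
Qed.

Record sheaf_hom F G := SheafHom {
  shom :> forall U, F U -> G U;
  shom_linear : forall U (f : OX U) (s t : F U),
    shom (f *: s + t) = f *: shom s + shom t;
  shom_res : forall U V (h : V `<=` U) (s : F U),
    res h (shom s) = shom (res h s) }.

Lemma glue_natural F G U (I : Type) (V : I -> opens X)
    (phi : forall i W, W `<=` V i -> F W -> G W) :
  covers U V ->
  (forall i W W' (h : W `<=` V i) (k : W' `<=` W) (l : W' `<=` V i) s,
     res k (phi i W h s) = phi i W' l (res k s)) ->
  (forall i j W (hi : W `<=` V i) (hj : W `<=` V j) s,
     phi i W hi s = phi j W hj s) ->
  exists psi : forall W, W `<=` U -> F W -> G W,
    (forall W W' (h : W `<=` U) (k : W' `<=` W) (l : W' `<=` U) s,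
       res k (psi W h s) = psi W' l (res k s)) /\
    (forall i W (h : W `<=` U) (hi : W `<=` V i) s, psi W h s = phi i W hi s).
Proof.
move=> cov nat agree.
have glue W (h : W `<=` U) s : exists t : G W,
    forall i W' (k : W' `<=` W) (l : W' `<=` V i),
      res k t = phi i W' l (res k s).
  pose VW i := opensI (V i) W.
  have hV i : VW i `<=` V i by apply: subIsetl.
  have hW i : VW i `<=` W by apply: subIsetr.
  have covW : covers W VW.
    by move=> x Wx; have [i Vx] := cov x (h x Wx); exists i.
  have [t tP] : exists t : G W, forall i, res (hW i) t = phi i _ (hV i) (res (hW i) s).
    apply: sheaf_glue => // i j Z hi hj.
    have li : Z `<=` V i by move=> x /hi /hV.
    have lj : Z `<=` V j by move=> x /hj /hV.
    have lW : Z `<=` W by move=> x /hi /hW.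
    rewrite (nat _ _ _ _ hi li) (nat _ _ _ _ hj lj).
    by rewrite !(res_comp _ _ lW); apply: agree.
  exists t => i W' k l.
  have m : W' `<=` VW i by move=> x W'x; split; [apply: l|apply: k].
  by rewrite -(res_comp (hW i) m k t) tP (nat _ _ _ _ _ l) (res_comp _ _ k).
pose psi W h s := projT1 (cid (glue W h s)).
have psiP W h s i W' k l : res k (psi W h s) = phi i W' l (res k s).
  exact: (projT2 (cid (glue W h s))).
exists psi; split=> [W W' h k l s|i W h hi s]; last first.
  have id : W `<=` W by [].
  by rewrite -[LHS](res_id id) (psiP _ _ _ i _ _ hi) res_id.
pose VW i := opensI (V i) W'.
have hV i : VW i `<=` V i by apply: subIsetl.
have hW i : VW i `<=` W' by apply: subIsetr.
apply: (@sheaf_separated _ _ _ G W' I VW hW) => [x W'x|i].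
  by have [i Vx] := cov x (l x W'x); exists i.
have kW i' : VW i' `<=` W by move=> x /hW /k.
by rewrite (res_comp _ _ (kW i)) !(psiP _ _ _ i _ _ (hV i)) (res_comp _ _ (kW i)).
Qed.

Section HomSheaf.
Local Obligation Tactic := idtac.
Context (F G : module_sheaf X).

(* The sections over U of Hom(F, G) are the morphisms from F restricted to U to G
   restricted to U; similarly for [derivation] below. *)
Record hom_over U := HomOver {
  hom_fun : forall V, V `<=` U -> F V -> G V;
  hom_linear : forall V (h : V `<=` U) (f : OX V) (s t : F V),
    hom_fun h (f *: s + t) = f *: hom_fun h s + hom_fun h t;
  hom_res : forall V W (h : V `<=` U) (k : W `<=` V) (l : W `<=` U) (s : F V),
    res k (hom_fun h s) = hom_fun l (res k s) }.

HB.instance Definition _ U := gen_eqMixin (hom_over U).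
HB.instance Definition _ U := gen_choiceMixin (hom_over U).

Lemma hom_ext U (a b : hom_over U) :
  (forall V (h : V `<=` U) s, hom_fun a h s = hom_fun b h s) -> a = b.
Proof.
case: a b => [a al ar] [b bl br] /= ab.
have e : a = b by apply: functional_extensionality_dep => V;
  apply/funext => h; apply/funext => s.
by case: b / e bl br ab => bl br _; congr HomOver; apply: Prop_irrelevance.
Qed.

Program Definition hom_zero U := @HomOver U (fun V h s => 0) _ _.
Next Obligation. by move=> * /=; rewrite scaler0 addr0. Qed.
Next Obligation. by move=> * /=; rewrite res0. Qed.

Program Definition hom_add U (a b : hom_over U) :=
  @HomOver U (fun V h s => hom_fun a h s + hom_fun b h s) _ _.
Next Obligation. by move=> U a b * /=; rewrite !hom_linear scalerDr addrACA. Qed.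
Next Obligation. by move=> U a b V W h k l s /=; rewrite resD !(hom_res _ _ _ l). Qed.

Program Definition hom_opp U (a : hom_over U) :=
  @HomOver U (fun V h s => - hom_fun a h s) _ _.
Next Obligation. by move=> * /=; rewrite hom_linear scalerN opprD. Qed.
Next Obligation. by move=> U a V W h k l s /=; rewrite resN !(hom_res _ _ _ l). Qed.

Program Definition hom_scale U (f : OX U) (a : hom_over U) :=
  @HomOver U (fun V h s => Ores h f *: hom_fun a h s) _ _.
Next Obligation.
by move=> * /=; rewrite hom_linear scalerDr !scalerA mulrC.
Qed.
Next Obligation.
by move=> U f a V W h k l s /=; rewrite resZ (Ores_comp _ _ l) (hom_res _ _ _ l).
Qed.

Program Definition hom_zmodMixin U :=
  @GRing.isZmodule.Build (hom_over U) (hom_zero U) (@hom_opp U) (@hom_add U)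
    _ _ _ _.
Next Obligation. by move=> U a b c; apply: hom_ext => *; apply: addrA. Qed.
Next Obligation. by move=> U a b; apply: hom_ext => *; apply: addrC. Qed.
Next Obligation. by move=> U a; apply: hom_ext => *; apply: add0r. Qed.
Next Obligation. by move=> U a; apply: hom_ext => *; apply: addNr. Qed.
HB.instance Definition _ U := hom_zmodMixin U.

Program Definition hom_lmodMixin U :=
  @GRing.Zmodule_isLmodule.Build (OX U) (hom_over U) (@hom_scale U) _ _ _ _.
Next Obligation.
by move=> U f g a; apply: hom_ext => * /=; rewrite scalerA -OresM.
Qed.
Next Obligation.
by move=> U a; apply: hom_ext => * /=; rewrite Ores1 scale1r.
Qed.
Next Obligation.
by move=> U f a b; apply: hom_ext => * /=; rewrite scalerDr.
Qed.
Next Obligation.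
by move=> U a f g; apply: hom_ext => * /=; rewrite OresD scalerDl.
Qed.
HB.instance Definition _ U := hom_lmodMixin U.

Definition hom_restrict U V (h : V `<=` U) (a : hom_over U) : hom_over V :=
  @HomOver V (fun W k s => hom_fun a (subset_trans k h) s)
    (fun W k => hom_linear a _)
    (fun W Z k l m => hom_res a _ _ _).

Program Definition hom_sheaf : module_sheaf X :=
  @ModuleSheaf _ _ X (fun U => hom_over U) hom_restrict _ _ _ _ _.
Next Obligation.
move=> U V h f a b; apply: hom_ext => W k s /=.
by rewrite (Ores_comp _ _ (subset_trans k h)).
Qed.
Next Obligation.
move=> U h a; apply: hom_ext => W k s /=.
by congr (hom_fun a _ s); apply: Prop_irrelevance.
Qed.
Next Obligation.
move=> U V W h k l a; apply: hom_ext => Z m s /=.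
by congr (hom_fun a _ s); apply: Prop_irrelevance.
Qed.
Next Obligation.
move=> U I V h a b cov ab; apply: hom_ext => W k s.
pose VW i := opensI (V i) W.
have hV i : VW i `<=` V i by apply: subIsetl.
have hW i : VW i `<=` W by apply: subIsetr.
apply: (@sheaf_separated _ _ _ G W I VW hW) => [x Wx|i].
  by have [i Vx] := cov x (k x Wx); exists i.
have := congr1 (fun a : hom_over (V i) => hom_fun a (hV i) (res (hW i) s)) (ab i).
by rewrite /= -!(hom_res _ k).
Qed.
Next Obligation.
move=> U I V h a cov agree.
have agree' i j W (hi : W `<=` V i) (hj : W `<=` V j) s :
    hom_fun (a i) hi s = hom_fun (a j) hj s.
  have /(congr1 (fun b : hom_over W => hom_fun b (@subset_refl _ _) s)) :=
    agree i j W hi hj.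
  rewrite /= => e; apply: etrans (etrans e _);
    congr (hom_fun _ _ s); exact: Prop_irrelevance.
have [psi [psiN psiE]] := @glue_natural F G U I V
  (fun i W k s => hom_fun (a i) k s) cov
  (fun i W W' h k l s => hom_res (a i) h k l s) agree'.
have psiL W (k : W `<=` U) f s t : psi W k (f *: s + t) = f *: psi W k s + psi W k t.
  pose VW i := opensI (V i) W.
  have hV i : VW i `<=` V i by apply: subIsetl.
  have hW i : VW i `<=` W by apply: subIsetr.
  apply: (@sheaf_separated _ _ _ G W I VW hW) => [x Wx|i].
    by have [i Vx] := cov x (k x Wx); exists i.
  have hU : VW i `<=` U by move=> x /hW /k.
  rewrite res_linear !(psiN _ _ _ _ hU) !(psiE _ _ _ (hV i)) res_linear.
  exact: hom_linear.
exists (@HomOver U psi psiL psiN) => i; apply: hom_ext => W k s /=.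
exact: psiE.
Qed.

End HomSheaf.

Local Obligation Tactic := idtac.

Program Definition O_sheaf : module_sheaf X :=
  @ModuleSheaf _ _ X (fun U => (OX U)^o) (fun U V h f => Ores h f) _ _ _ _ _.
Next Obligation. by move=> * /=; apply: O_ext. Qed.
Next Obligation. by move=> *; apply: Ores_id. Qed.
Next Obligation. by move=> *; apply: Ores_comp. Qed.
Next Obligation. by move=> U I V h s t; apply: O_separated. Qed.
Next Obligation. by move=> U I V h s; apply: O_glue. Qed.

Definition dual F : module_sheaf X := hom_sheaf F O_sheaf.

Definition pairing F U (a : dual F U) (s : F U) : OX U :=
  hom_fun a (@subset_refl _ U) s.

Program Definition dual_map F G (phi : sheaf_hom F G) :
    sheaf_hom (dual G) (dual F) :=
  @SheafHom (dual G) (dual F)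
    (fun U a => @HomOver F O_sheaf U (fun V h s => hom_fun a h (phi V s)) _ _) _ _.
Next Obligation. by move=> F G phi U a V h f s t /=; rewrite shom_linear hom_linear. Qed.
Next Obligation.
by move=> F G phi U a V W h k l s /=; rewrite -shom_res; apply: (hom_res a).
Qed.
Next Obligation. by move=> *; apply: hom_ext. Qed.
Next Obligation. by move=> *; apply: hom_ext. Qed.

Program Definition free_sheaf n : module_sheaf X :=
  @ModuleSheaf _ _ X (fun U => 'I_n -> (OX U)^o) (fun U V h s i => Ores h (s i)) _ _ _ _ _.
Next Obligation. by move=> *; apply/funext => i; apply: O_ext. Qed.
Next Obligation. by move=> *; apply/funext => i; apply: Ores_id. Qed.
Next Obligation. by move=> *; apply/funext => i; apply: Ores_comp. Qed.
Next Obligation.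
move=> n U I V h s t cov st; apply/funext => j.
by apply: (O_separated (h := h) cov) => i; apply: (congr1 (fun s => s j) (st i)).
Qed.
Next Obligation.
move=> n U I V h s cov agree.
have /choice[t tP] : forall j, exists t : OX U, forall i, Ores (h i) t = s i j.
  move=> j; apply: O_glue => // i i' W hi hi'.
  exact: (congr1 (fun s => s j) (agree i i' W hi hi')).
by exists t => i; apply/funext => j; apply: tP.
Qed.

(* F restricted to U is isomorphic to the restriction of [free_sheaf n]. *)
Definition free_on F n U :=
  exists (a : hom_over (free_sheaf n) F U) (b : hom_over F (free_sheaf n) U),
    (forall V (h : V `<=` U) s, hom_fun b h (hom_fun a h s) = s) /\
    (forall V (h : V `<=` U) s, hom_fun a h (hom_fun b h s) = s).

Definition locally_free_finite F :=
  forall x : X, exists (U : opens X) (n : nat), oset U x /\ free_on F n U.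

Section Derivations.
Local Obligation Tactic := idtac.

Record derivation U := Derivation {
  der_fun : forall V, V `<=` U -> OX V -> OX V;
  der_linear : forall V (h : V `<=` U) (c : K) (f g : OX V),
    der_fun h (Ocst V c * f + g) = Ocst V c * der_fun h f + der_fun h g;
  der_leibniz : forall V (h : V `<=` U) (f g : OX V),
    der_fun h (f * g) = f * der_fun h g + g * der_fun h f;
  der_res : forall V W (h : V `<=` U) (k : W `<=` V) (l : W `<=` U) (f : OX V),
    Ores k (der_fun h f) = der_fun l (Ores k f) }.

HB.instance Definition _ U := gen_eqMixin (derivation U).
HB.instance Definition _ U := gen_choiceMixin (derivation U).

Lemma der_ext U (a b : derivation U) :
  (forall V (h : V `<=` U) f, der_fun a h f = der_fun b h f) -> a = b.
Proof.
case: a b => [a al am ar] [b bl bm br] /= ab.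
have e : a = b by apply: functional_extensionality_dep => V;
  apply/funext => h; apply/funext => f.
by case: b / e bl bm br ab => bl bm br _;
  congr Derivation; apply: Prop_irrelevance.
Qed.

Lemma der_additive U (a : derivation U) V (h : V `<=` U) :
  {morph der_fun a h : f g / f + g}.
Proof.
by move=> f g; have := der_linear a h 1 f g; rewrite (_ : Ocst V 1 = 1) ?mul1r //; apply: O_ext.
Qed.

Lemma der0 U (a : derivation U) V (h : V `<=` U) : der_fun a h 0 = 0.
Proof.
by apply: (@addrI _ (der_fun a h 0)); rewrite -der_additive !addr0.
Qed.

Lemma derN U (a : derivation U) V (h : V `<=` U) f :
  der_fun a h (- f) = - der_fun a h f.
Proof.
by apply: (@addrI _ (der_fun a h f)); rewrite -der_additive !subrr der0.
Qed.

Lemma derZ U (a : derivation U) V (h : V `<=` U) c f :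
  der_fun a h (Ocst V c * f) = Ocst V c * der_fun a h f.
Proof. by have := der_linear a h c f 0; rewrite !addr0 der0 addr0. Qed.

Program Definition der_zero U := @Derivation U (fun V h f => 0) _ _ _.
Next Obligation. by move=> * /=; rewrite mulr0 addr0. Qed.
Next Obligation. by move=> * /=; rewrite !mulr0 addr0. Qed.
Next Obligation. by move=> * /=; apply: O_ext. Qed.

Program Definition der_add U (a b : derivation U) :=
  @Derivation U (fun V h f => der_fun a h f + der_fun b h f) _ _ _.
Next Obligation. by move=> U a b * /=; rewrite !der_linear mulrDr addrACA. Qed.
Next Obligation. by move=> U a b * /=; rewrite !der_leibniz !mulrDr addrACA. Qed.
Next Obligation.
by move=> U a b V W h k l f /=; rewrite OresD !(der_res _ _ _ l).
Qed.

Program Definition der_opp U (a : derivation U) :=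
  @Derivation U (fun V h f => - der_fun a h f) _ _ _.
Next Obligation. by move=> U a * /=; rewrite der_linear mulrN opprD. Qed.
Next Obligation. by move=> U a * /=; rewrite der_leibniz !mulrN opprD. Qed.
Next Obligation.
by move=> U a V W h k l f /=; rewrite -(der_res _ h k l); apply: O_ext.
Qed.

Program Definition der_scale U (e : OX U) (a : derivation U) :=
  @Derivation U (fun V h f => Ores h e * der_fun a h f) _ _ _.
Next Obligation.
by move=> U e a * /=; rewrite der_linear mulrDr !mulrA (mulrC (Ores _ _)).
Qed.
Next Obligation.
by move=> U e a V h f g /=; rewrite der_leibniz mulrDr !mulrA !(mulrC (Ores _ _)).
Qed.
Next Obligation.
by move=> U e a V W h k l f /=; rewrite OresM (Ores_comp _ _ l) (der_res _ _ _ l).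
Qed.

Program Definition der_zmodMixin U :=
  @GRing.isZmodule.Build (derivation U) (der_zero U) (@der_opp U) (@der_add U)
    _ _ _ _.
Next Obligation. by move=> U a b c; apply: der_ext => *; apply: addrA. Qed.
Next Obligation. by move=> U a b; apply: der_ext => *; apply: addrC. Qed.
Next Obligation. by move=> U a; apply: der_ext => *; apply: add0r. Qed.
Next Obligation. by move=> U a; apply: der_ext => *; apply: addNr. Qed.
HB.instance Definition _ U := der_zmodMixin U.

Program Definition der_lmodMixin U :=
  @GRing.Zmodule_isLmodule.Build (OX U) (derivation U) (@der_scale U) _ _ _ _.
Next Obligation.
by move=> U f g a; apply: der_ext => * /=; rewrite mulrA -OresM.
Qed.
Next Obligation.
by move=> U a; apply: der_ext => * /=; rewrite Ores1 mul1r.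
Qed.
Next Obligation.
by move=> U f a b; apply: der_ext => * /=; rewrite mulrDr.
Qed.
Next Obligation.
by move=> U a f g; apply: der_ext => * /=; rewrite OresD mulrDl.
Qed.
HB.instance Definition _ U := der_lmodMixin U.

Definition der_restrict U V (h : V `<=` U) (a : derivation U) : derivation V :=
  @Derivation V (fun W k f => der_fun a (subset_trans k h) f)
    (fun W k => der_linear a _)
    (fun W k => der_leibniz a _)
    (fun W Z k l m => der_res a _ _ _).

Program Definition tangent : module_sheaf X :=
  @ModuleSheaf _ _ X (fun U => derivation U) der_restrict _ _ _ _ _.
Next Obligation.
move=> U V h f a b; apply: der_ext => W k s /=.
by rewrite (Ores_comp _ _ (subset_trans k h)).
Qed.
Next Obligation.
move=> U h a; apply: der_ext => W k s /=.
by congr (der_fun a _ s); apply: Prop_irrelevance.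
Qed.
Next Obligation.
move=> U V W h k l a; apply: der_ext => Z m s /=.
by congr (der_fun a _ s); apply: Prop_irrelevance.
Qed.
Next Obligation.
move=> U I V h a b cov ab; apply: der_ext => W k s.
pose VW i := opensI (V i) W.
have hV i : VW i `<=` V i by apply: subIsetl.
have hW i : VW i `<=` W by apply: subIsetr.
apply: (O_separated (V := VW) (h := hW)) => [x Wx|i].
  by have [i Vx] := cov x (k x Wx); exists i.
have := congr1 (fun a : derivation (V i) => der_fun a (hV i) (Ores (hW i) s)) (ab i).
by rewrite /= -!(der_res _ k).
Qed.
Next Obligation.
move=> U I V h a cov agree.
have agree' i j W (hi : W `<=` V i) (hj : W `<=` V j) s :
    der_fun (a i) hi s = der_fun (a j) hj s.
  have /(congr1 (fun b : derivation W => der_fun b (@subset_refl _ _) s)) :=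
    agree i j W hi hj.
  rewrite /= => e; apply: etrans (etrans e _);
    congr (der_fun _ _ s); exact: Prop_irrelevance.
have [psi [psiN psiE]] := @glue_natural O_sheaf O_sheaf U I V
  (fun i W k s => der_fun (a i) k s) cov
  (fun i W W' h k l s => der_res (a i) h k l s) agree'.
rewrite /= in psi psiN psiE.
have psiL W (k : W `<=` U) c f g :
    psi W k (Ocst W c * f + g) = Ocst W c * psi W k f + psi W k g.
  pose VW i := opensI (V i) W.
  have hV i : VW i `<=` V i by apply: subIsetl.
  have hW i : VW i `<=` W by apply: subIsetr.
  apply: (O_separated (V := VW) (h := hW)) => [x Wx|i].
    by have [i Vx] := cov x (k x Wx); exists i.
  have hU : VW i `<=` U by move=> x /hW /k.
  rewrite OresD OresM !(psiN _ _ _ _ hU) !(psiE _ _ _ (hV i)) OresD OresM.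
  by rewrite Ores_cst; apply: der_linear.
have psiM W (k : W `<=` U) f g :
    psi W k (f * g) = f * psi W k g + g * psi W k f.
  pose VW i := opensI (V i) W.
  have hV i : VW i `<=` V i by apply: subIsetl.
  have hW i : VW i `<=` W by apply: subIsetr.
  apply: (O_separated (V := VW) (h := hW)) => [x Wx|i].
    by have [i Vx] := cov x (k x Wx); exists i.
  have hU : VW i `<=` U by move=> x /hW /k.
  rewrite OresD !OresM !(psiN _ _ _ _ hU) !(psiE _ _ _ (hV i)) OresM.
  exact: der_leibniz.
exists (@Derivation U psi psiL psiM psiN) => i; apply: der_ext => W k s /=.
exact: psiE.
Qed.

Definition der_app U (D : derivation U) (f : OX U) : OX U :=
  der_fun D (@subset_refl _ U) f.

Program Definition der_bracket U (a b : derivation U) :=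
  @Derivation U
    (fun V h f => der_fun a h (der_fun b h f) - der_fun b h (der_fun a h f)) _ _ _.
Next Obligation.
move=> U a b V h c f g /=; rewrite !der_linear.
by rewrite mulrBr opprD addrACA.
Qed.
Next Obligation.
move=> U a b V h f g /=; rewrite !der_leibniz !der_additive !der_leibniz.
set A := der_fun a h; set B := der_fun b h.
rewrite !mulrBr (mulrC (B g)) (mulrC (B f)).
rewrite [X in X - _]addrACA [X in _ - X]addrACA.
rewrite [X in _ - (_ + X)]addrC.
by rewrite opprD [LHS]addrACA subrr addr0 opprD addrACA.
Qed.
Next Obligation.
move=> U a b V W h k l f /=.
have -> (s t : OX V) : Ores k (s - t) = Ores k s - Ores k t by exact: O_ext.
by rewrite !(der_res _ _ _ l).
Qed.

End Derivations.

Program Definition d_X U (f : OX U) : dual tangent U :=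
  @HomOver tangent O_sheaf U
    (fun V h (D : derivation V) => der_app D (Ores h f)) _ _.
Next Obligation. by move=> U f V h g s t; rewrite /der_app /= Ores_id. Qed.
Next Obligation.
move=> U f V W h k l D; rewrite /der_app /= (der_res _ _ _ k) (Ores_comp _ _ l).
by congr (der_fun _ _ _); apply: Prop_irrelevance.
Qed.

Record lie_algebroid_on F := LieAlgebroidOn {
  bracket : forall U, F U -> F U -> F U;
  anchor : sheaf_hom F tangent;
  bracket_linearl : forall U (c : K) (s t u : F U),
    bracket (Ocst U c *: s + t) u = Ocst U c *: bracket s u + bracket t u;
  bracket_linearr : forall U (c : K) (s t u : F U),
    bracket s (Ocst U c *: t + u) = Ocst U c *: bracket s t + bracket s u;
  bracketxx : forall U (s : F U), bracket s s = 0;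
  jacobi : forall U (s t u : F U),
    bracket s (bracket t u) + bracket t (bracket u s)
      + bracket u (bracket s t) = 0;
  bracket_res : forall U V (h : V `<=` U) (s t : F U),
    res h (bracket s t) = bracket (res h s) (res h t);
  anchor_bracket : forall U (s t : F U),
    anchor U (bracket s t) = der_bracket (anchor U s) (anchor U t);
  bracket_leibniz : forall U (f : OX U) (s t : F U),
    bracket s (f *: t) = f *: bracket s t + der_app (anchor U s) f *: t }.

Record lie_algebroid := LieAlgebroid {
  la_sheaf :> module_sheaf X;
  la_structure :> lie_algebroid_on la_sheaf }.

Record lie_algebroid_hom (E L : lie_algebroid) := LieAlgebroidHom {
  la_hom :> sheaf_hom E L;
  la_hom_bracket : forall U (s t : E U),
    la_hom U (bracket E s t) = bracket L (la_hom U s) (la_hom U t);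
  la_hom_anchor : forall U (s : E U), anchor L U (la_hom U s) = anchor E U s }.

Record lie_algebroid_over (L : lie_algebroid) F := LieAlgebroidOver {
  lao_structure : lie_algebroid_on F;
  lao_hom : lie_algebroid_hom (LieAlgebroid lao_structure) L }.

(* Graded O_X-algebras with degree-0 part O_X, as families of homogeneous
   parts.  The product of degrees k and l lands in any degree n provably equal
   to k + l, so that the axioms need no transport between degrees. *)
Record galgebra := GAlgebra {
  gpart :> nat -> module_sheaf X;
  gone : forall U, gpart 0 U;
  gmul : forall k l n, (k + l)%N = n ->
    forall U, gpart k U -> gpart l U -> gpart n U;
  gmul_linearl : forall k l n (h : (k + l)%N = n) U (f : OX U)
      (a b : gpart k U) (c : gpart l U),
    gmul h (f *: a + b) c = f *: gmul h a c + gmul h b c;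
  gmul_linearr : forall k l n (h : (k + l)%N = n) U (f : OX U)
      (a : gpart k U) (b c : gpart l U),
    gmul h a (f *: b + c) = f *: gmul h a b + gmul h a c;
  gone_res : forall U V (h : V `<=` U), res h (gone U) = gone V;
  gmul_res : forall k l n (h : (k + l)%N = n) U V (i : V `<=` U)
      (a : gpart k U) (b : gpart l U),
    res i (gmul h a b) = gmul h (res i a) (res i b);
  gmulA : forall k l m n p q (hkl : (k + l)%N = p) (hlm : (l + m)%N = q)
      (hl : (p + m)%N = n) (hr : (k + q)%N = n) U
      (a : gpart k U) (b : gpart l U) (c : gpart m U),
    gmul hl (gmul hkl a b) c = gmul hr a (gmul hlm b c);
  gmul1 : forall k (h : (0 + k)%N = k) U (a : gpart k U), gmul h (gone U) a = a;
  gmulr1 : forall k (h : (k + 0)%N = k) U (a : gpart k U), gmul h a (gone U) = a;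
  gpart0 : forall U, bijective (fun f : OX U => f *: gone U) }.

Definition graded_commutative (A : galgebra) :=
  forall k l n (hkl : (k + l)%N = n) (hlk : (l + k)%N = n) U
    (a : A k U) (b : A l U),
  gmul hkl a b = (-1) ^+ (k * l)%N *: gmul hlk b a.

Record galgebra_hom (A B : galgebra) := GAlgebraHom {
  ghom :> forall k, sheaf_hom (A k) (B k);
  ghom1 : forall U, ghom 0 U (gone A U) = gone B U;
  ghomM : forall k l n (h : (k + l)%N = n) U (a : A k U) (b : A l U),
    ghom n U (gmul h a b) = gmul h (ghom k U a) (ghom l U b) }.

Definition squares_to_zero F (A : galgebra) (j : sheaf_hom F (A 1%N)) :=
  forall (h : (1 + 1)%N = 2%N) U (s : F U), gmul h (j U s) (j U s) = 0.

(* The universal property of the exterior algebra of the O_X-module F. *)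
Definition is_exterior_algebra F (A : galgebra) (j : sheaf_hom F (A 1%N)) :=
  squares_to_zero j /\
  forall (B : galgebra) (f : sheaf_hom F (B 1%N)), squares_to_zero f ->
    exists g : galgebra_hom A B,
      (forall U s, g 1%N U (j U s) = f U s) /\
      forall g' : galgebra_hom A B, (forall U s, g' 1%N U (j U s) = f U s) ->
        forall k U (a : A k U), g' k U a = g k U a.

Record differential (A : galgebra) := Differential {
  dfun :> forall k U, A k U -> A k.+1 U;
  dfun_linear : forall k U (c : K) (a b : A k U),
    dfun (Ocst U c *: a + b) = Ocst U c *: dfun a + dfun b;
  dfun_res : forall k U V (h : V `<=` U) (a : A k U),
    res h (dfun a) = dfun (res h a);
  dfun_dfun : forall k U (a : A k U), dfun (dfun a) = 0;
  dfunM : forall k l n (h : (k + l)%N = n) (hl : (k.+1 + l)%N = n.+1)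
      (hr : (k + l.+1)%N = n.+1) U (a : A k U) (b : A l U),
    dfun (gmul h a b) = gmul hl (dfun a) b + (-1) ^+ k *: gmul hr a (dfun b) }.

Record dga := DGA {
  dga_algebra :> galgebra;
  dga_commutative : graded_commutative dga_algebra;
  dga_diff : differential dga_algebra }.

Record dga_hom (A B : dga) := DGAHom {
  dga_ghom :> galgebra_hom A B;
  dga_hom_diff : forall k U (a : A k U),
    dga_ghom k.+1 U (dga_diff A k U a) = dga_diff B k U (dga_ghom k U a) }.

Fixpoint gprod (A : galgebra) U k : ('I_k -> A 1%N U) -> A k U :=
  match k with
  | 0 => fun=> gone A U
  | k'.+1 => fun a =>
      gmul (add1n k') (a ord0) (@gprod A U k' (fun i => a (lift ord0 i)))
  end.

(* [ev k U w D] is w(D_1 /\ ... /\ D_k), for w a section of the exterior power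
   of degree k of the dual of F, where
   (a_1 /\ ... /\ a_k)(D_1 /\ ... /\ D_k) = det (a_i(D_j)). *)
Definition is_evaluation F (A : galgebra) (j : sheaf_hom (dual F) (A 1%N))
    (ev : forall k U, A k U -> ('I_k -> F U) -> OX U) :=
  [/\ forall k U (f : OX U) (w w' : A k U) D,
        ev k U (f *: w + w') D = f * ev k U w D + ev k U w' D,
      forall k U V (h : V `<=` U) (w : A k U) D,
        Ores h (ev k U w D) = ev k V (res h w) (fun p => res h (D p))
    & forall k U (a : 'I_k -> dual F U) D,
        ev k U (gprod (fun p => j U (a p))) D =
        \det (\matrix_(p, q) pairing (a p) (D q))].

(* The indices start at 0, hence the sign (-1)^i in the first sum. *)
Definition CE_formula (L : lie_algebroid) k U (w : ('I_k -> L U) -> OX U)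
    (D : 'I_k.+1 -> L U) : OX U :=
  \sum_(i < k.+1)
     (-1) ^+ i * der_app (anchor L U (D i)) (w (fun p => D (lift i p))) +
  \sum_(i < k.+1) \sum_(j < k.+1 | (i < j)%N)
     (-1) ^+ (i + j)%N *
     w (fun p : 'I_k =>
          nth 0 (bracket L (D i) (D j) ::
                 [seq D q | q <- enum 'I_k.+1 & (q != i) && (q != j)]) p).

(* The Chevalley-Eilenberg-de Rham algebra of L.  All the data is determined by
   L up to unique isomorphism: a section of the exterior algebra is locally a
   sum of products of sections of the dual of L, whence the uniqueness of
   [ce_eval]; and a section of the exterior algebra of the dual of a locally
   free module of finite rank is determined by its values. *)
Record CE_algebra (L : lie_algebroid) := CEAlgebra {
  ce_dga :> dga;
  ce_gen : sheaf_hom (dual L) (ce_dga 1%N);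
  ce_exterior : is_exterior_algebra ce_gen;
  ce_eval : forall k U, ce_dga k U -> ('I_k -> L U) -> OX U;
  ce_evalP : is_evaluation ce_gen ce_eval;
  ce_diffE : forall k U (w : ce_dga k U) (D : 'I_k.+1 -> L U),
    ce_eval (dga_diff ce_dga k U w) D = CE_formula (ce_eval w) D }.

Record CE_dga_structure (L : lie_algebroid) (Omega : CE_algebra L)
    (A : galgebra) := CEDGAStructure {
  cs_commutative : graded_commutative A;
  cs_diff : differential A;
  cs_hom : dga_hom Omega (DGA cs_commutative cs_diff);
  cs_diff0 : forall U (f : OX U),
    cs_diff 0%N U (f *: gone A U) =
    cs_hom 1%N U (ce_gen Omega U (dual_map (anchor L) U (d_X f))) }.

End SheafTheory.

(* A chart of X on U with model the subset S of K^n, for the topology [tau] on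
   K^n: [phi] is a homeomorphism of U onto S identifying the sections of O_X
   over V `<=` U with the functions g such that [reg (phi @` V) g], where
   [reg W g] means that g is regular on the relatively open subset W of S. *)
Definition chart {K : fieldType} {KO : set (set K)} (X : ringed_space KO) n
    (tau : set (set 'rV[K]_n)) (S : set 'rV[K]_n)
    (reg : set 'rV[K]_n -> ('rV[K]_n -> K) -> Prop)
    (U : opens X) (phi : X -> 'rV[K]_n) :=
  [/\ {in oset U &, injective phi},
      phi @` oset U = S,
      forall W : set X, W `<=` U ->
        (open W <-> exists2 A, tau A & phi @` W = A `&` S)
    & forall V : opens X, V `<=` U -> forall f : V -> K,
        (regular X V f <->
         exists2 g, forall v, f v = g (phi (val v)) & reg (phi @` oset V) g)].

Section Euclidean.
Context {R : realType}.

Definition iter_derive n (vs : seq 'rV[R]_n) (g : 'rV[R]_n -> R) :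
    'rV[R]_n -> R :=
  foldr (fun v h x => derive (h : _ -> R^o) x v) g vs.

Definition smooth_on n (W : set 'rV[R]_n) (g : 'rV[R]_n -> R) :=
  forall vs x, W x -> differentiable (iter_derive vs g : _ -> R^o) x.

Definition smooth_manifold (X : ringed_space (@open R)) :=
  [/\ hausdorff_space X, @second_countable X
    & forall x : X, exists n S U phi,
        [/\ oset U x, open S & chart (X := X) (n := n) open S (@smooth_on n) U phi]].

Notation C := (R[i] : numFieldType).

Definition holomorphic_on n (W : set 'rV[C]_n) (g : 'rV[C]_n -> C) :=
  forall x, W x -> differentiable (g : _ -> C^o) x.

Definition complex_manifold (X : ringed_space (@open C)) :=
  [/\ hausdorff_space X, @second_countable X
    & forall x : X, exists n S U phi,
        [/\ oset U x, open S
          & chart (X := X) (n := n) open S (@holomorphic_on n) U phi]].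

Definition analytic_set n (S : set 'rV[C]_n) :=
  exists (D : set 'rV[C]_n) m (h : 'I_m -> 'rV[C]_n -> C),
    [/\ open D, forall i, holomorphic_on D (h i)
      & S = D `&` [set z | forall i, h i z = 0]].

Definition locally_holomorphic n (W : set 'rV[C]_n) (g : 'rV[C]_n -> C) :=
  forall x, W x -> exists (D : set 'rV[C]_n) (h : 'rV[C]_n -> C),
    [/\ open D, D x, holomorphic_on D h & forall z, D z -> W z -> g z = h z].

(* Analytic spaces are reduced, as O_X consists of functions. *)
Definition analytic_space (X : ringed_space (@open C)) :=
  hausdorff_space X /\
  forall x : X, exists n S U phi,
    [/\ oset U x, analytic_set S
      & chart (X := X) (n := n) open S (@locally_holomorphic n) U phi].
End Euclidean.

Section Zariski.
Context {K : fieldType}.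

Definition zariski_line : set (set K) :=
  [set A | exists P : set {poly K}, ~` A = [set x | forall p, P p -> root p x]].

Definition zariski_closed n (A : set 'rV[K]_n) :=
  exists P : set (mpoly.mpoly n K),
    A = [set x | forall p, P p -> mpoly.meval (x ord0) p = 0].

Definition zariski_open n : set (set 'rV[K]_n) :=
  [set A | zariski_closed (~` A)].

Definition locally_rational n (W : set 'rV[K]_n) (g : 'rV[K]_n -> K) :=
  forall x, W x -> exists p q : mpoly.mpoly n K,
    mpoly.meval (x ord0) q != 0 /\
    forall z, W z -> mpoly.meval (z ord0) q != 0 ->
      g z = mpoly.meval (z ord0) p / mpoly.meval (z ord0) q.

(* Finitely many affine charts; the last clause says that the diagonal of X is
   closed in X x X. *)
Definition algebraic_variety (X : ringed_space zariski_line) :=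
  exists m (n : 'I_m -> nat) (S : forall i, set 'rV[K]_(n i))
      (U : 'I_m -> opens X) (phi : forall i, X -> 'rV[K]_(n i)),
    [/\ forall x : X, exists i, oset (U i) x,
        forall i, zariski_closed (S i),
        forall i, chart (X := X) (n := n i) (@zariski_open (n i)) (S i)
                    (@locally_rational (n i)) (U i) (phi i)
      & forall i j, zariski_closed
          [set row_mx (phi i x) (phi j x) | x in oset (U i) `&` oset (U j)]].
End Zariski.

Inductive special :
    forall (K : fieldType) (KO : set (set K)), ringed_space KO -> Prop :=
| special_smooth (R : realType) (X : ringed_space (@open R)) :
    smooth_manifold X -> special X
| special_complex (R : realType)
    (X : ringed_space (@open (R[i] : numFieldType))) :
    complex_manifold X -> special X
| special_analytic (R : realType)
    (X : ringed_space (@open (R[i] : numFieldType))) :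
    analytic_space X -> special X
| special_algebraic (K : closedFieldType) (X : ringed_space (@zariski_line K)) :
    [pchar K] =i pred0 -> algebraic_variety X -> special X.

(* Main.v *)
Require Import Defs.
From HB Require Import structures.
From mathcomp Require Import all_boot all_order all_algebra.
From mathcomp Require Import all_classical.
From mathcomp Require Import reals complex ring.

(** The universal property of the exterior algebra A of E^* is only available
    for graded O_X-algebras on the whole of X. Applied to a square-zero
    extension A + M of A by a graded bimodule M, on which O_X acts through
    f |-> f + df for a derivation d : O_X -> M^0, it extends any map E^* -> M^1
    satisfying the Leibniz rule over d to a derivation A -> M; applied to a
    subalgebra of A it yields induction on products of sections of E^*. With
    M = A[1] the derivations are the differentials of A, with
    M = Hom(E, A[-1]) they give the contractions i_D. In characteristic 0,
    Euler's identity sum_i x_i i_(e_i) = k on A^k in a local frame e_i with dual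
    frame x_i shows that a form is determined by its contractions.

    For a derivation d of degree 1 of A and L_D = [d, i_D], the relation
    [L_D, i_D'] = i_[D, D'] between a bracket on E and d can be checked on E^*;
    it is Cartan's formula for d in terms of the bracket and the anchor
    D |-> i_D d. By Cartan calculus, d^2 = 0 on O_X says that the anchor is a
    morphism, and d^2 = 0 on A^1 then is the Jacobi identity. A morphism
    phi : E -> L corresponds to the transpose psi_1 of phi on 1-forms, as E and L
    are reflexive, and psi commutes with d in degree 1 exactly when phi preserves
    the brackets. *)

Section LieAlgebroids.
Set Implicit Arguments.
Unset Strict Implicit.
Unset Printing Implicit Defensive.
Import GRing.Theory.
Local Open Scope classical_set_scope.
Local Open Scope ring_scope.
Local Obligation Tactic := idtac.

(** * Square-zero extensions *)

Section Bimodules.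
Context {K : fieldType} {KO : set (set K)} {X : ringed_space KO}.
Implicit Types (U V W : opens X) (E F G : module_sheaf X).

Section Galgebra.
Variable A : galgebra (X := X).

Lemma gmulDl k l n (h : (k + l)%N = n) U (a b : A k U) (c : A l U) :
  gmul h (a + b) c = gmul h a c + gmul h b c.
Proof. by have := gmul_linearl h 1 a b c; rewrite !scale1r. Qed.

Lemma gmulDr k l n (h : (k + l)%N = n) U (a : A k U) (b c : A l U) :
  gmul h a (b + c) = gmul h a b + gmul h a c.
Proof. by have := gmul_linearr h 1 a b c; rewrite !scale1r. Qed.

Lemma gmul0l k l n (h : (k + l)%N = n) U (c : A l U) :
  gmul h (0 : A k U) c = 0.
Proof. by apply: (addrI (gmul h 0 c)); rewrite -gmulDl !addr0. Qed.

Lemma gmul0r k l n (h : (k + l)%N = n) U (a : A k U) :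
  gmul h a (0 : A l U) = 0.
Proof. by apply: (addrI (gmul h a 0)); rewrite -gmulDr !addr0. Qed.

Lemma gmulZl k l n (h : (k + l)%N = n) U f (a : A k U) (c : A l U) :
  gmul h (f *: a) c = f *: gmul h a c.
Proof. by have := gmul_linearl h f a 0 c; rewrite gmul0l !addr0. Qed.

Lemma gmulZr k l n (h : (k + l)%N = n) U f (a : A k U) (c : A l U) :
  gmul h a (f *: c) = f *: gmul h a c.
Proof. by have := gmul_linearr h f a c 0; rewrite gmul0r !addr0. Qed.

Lemma gmulNl k l n (h : (k + l)%N = n) U (a : A k U) (c : A l U) :
  gmul h (- a) c = - gmul h a c.
Proof. by rewrite -scaleN1r gmulZl scaleN1r. Qed.

Lemma gmulNr k l n (h : (k + l)%N = n) U (a : A k U) (c : A l U) :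
  gmul h a (- c) = - gmul h a c.
Proof. by rewrite -scaleN1r gmulZr scaleN1r. Qed.

Lemma gmul_suml k l n (h : (k + l)%N = n) U I (r : seq I) (a : I -> A k U)
    (c : A l U) :
  gmul h (\sum_(i <- r) a i) c = \sum_(i <- r) gmul h (a i) c.
Proof.
by elim/big_rec2: _ => [|i x y _ <-]; rewrite ?gmul0l ?gmulDl.
Qed.

Lemma gmul_sumr k l n (h : (k + l)%N = n) U I (r : seq I) (a : A k U)
    (c : I -> A l U) :
  gmul h a (\sum_(i <- r) c i) = \sum_(i <- r) gmul h a (c i).
Proof.
by elim/big_rec2: _ => [|i x y _ <-]; rewrite ?gmul0r ?gmulDr.
Qed.

Lemma gmul_irr k l n (h h' : (k + l)%N = n) U (a : A k U) (c : A l U) :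
  gmul h a c = gmul h' a c.
Proof. by rewrite (eq_irrelevance h h'). Qed.

Lemma gdegree0 U (a : A 0%N U) : exists f, a = f *: gone A U.
Proof. by have [g _ gK] := gpart0 A U; exists (g a); rewrite gK. Qed.

Lemma gone_inj U (f g : OX U) : f *: gone A U = g *: gone A U -> f = g.
Proof. by move/(bij_inj (gpart0 A U)). Qed.

End Galgebra.

Program Definition galgebra_id (A : galgebra (X := X)) : galgebra_hom A A :=
  @GAlgebraHom _ _ X A A (fun k => @SheafHom _ _ X (A k) (A k) (fun=> id) _ _) _ _.
Solve Obligations with by [].

Program Definition galgebra_comp (A B C : galgebra (X := X))
    (f : galgebra_hom B C) (g : galgebra_hom A B) : galgebra_hom A C :=
  @GAlgebraHom _ _ X A C
    (fun k => @SheafHom _ _ X (A k) (C k) (fun U a => f k U (g k U a)) _ _) _ _.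
Next Obligation. by move=> * /=; rewrite !shom_linear. Qed.
Next Obligation. by move=> * /=; rewrite !shom_res. Qed.
Next Obligation. by move=> * /=; rewrite !ghom1. Qed.
Next Obligation. by move=> * /=; rewrite !ghomM. Qed.

(** The map g and the identity both extend j, so the uniqueness clause of the universal property
    identifies them. *)
Lemma exterior_endo F (A : galgebra (X := X)) (j : sheaf_hom F (A 1%N))
    (A_ext : is_exterior_algebra j) (g : galgebra_hom A A) :
  (forall U s, g 1%N U (j U s) = j U s) -> forall k U (a : A k U), g k U a = a.
Proof.
move=> gj k U a; have [f [_ uniq_f]] := A_ext.2 A j A_ext.1.
by rewrite (uniq_f g) // -(uniq_f (galgebra_id A)).
Qed.

(** The two actions are separate data, so that the Koszul sign of an odd derivation can be carried
    by the left action alone. *)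
Record gbimodule (A : galgebra (X := X)) := GBimodule {
  bpart :> nat -> module_sheaf X;
  bmull : forall k l n, (k + l)%N = n ->
    forall U, A k U -> bpart l U -> bpart n U;
  bmulr : forall k l n, (k + l)%N = n ->
    forall U, bpart k U -> A l U -> bpart n U;
  bmull_linearl : forall k l n (h : (k + l)%N = n) U (f : OX U)
      (a b : A k U) (c : bpart l U),
    bmull h (f *: a + b) c = f *: bmull h a c + bmull h b c;
  bmull_linearr : forall k l n (h : (k + l)%N = n) U (f : OX U)
      (a : A k U) (b c : bpart l U),
    bmull h a (f *: b + c) = f *: bmull h a b + bmull h a c;
  bmulr_linearl : forall k l n (h : (k + l)%N = n) U (f : OX U)
      (a b : bpart k U) (c : A l U),
    bmulr h (f *: a + b) c = f *: bmulr h a c + bmulr h b c;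
  bmulr_linearr : forall k l n (h : (k + l)%N = n) U (f : OX U)
      (a : bpart k U) (b c : A l U),
    bmulr h a (f *: b + c) = f *: bmulr h a b + bmulr h a c;
  bmull_res : forall k l n (h : (k + l)%N = n) U V (i : V `<=` U)
      (a : A k U) (b : bpart l U),
    res i (bmull h a b) = bmull h (res i a) (res i b);
  bmulr_res : forall k l n (h : (k + l)%N = n) U V (i : V `<=` U)
      (a : bpart k U) (b : A l U),
    res i (bmulr h a b) = bmulr h (res i a) (res i b);
  bmullA : forall k l m n p q (hkl : (k + l)%N = p) (hlm : (l + m)%N = q)
      (hl : (p + m)%N = n) (hr : (k + q)%N = n) U
      (a : A k U) (b : A l U) (c : bpart m U),
    bmull hl (gmul hkl a b) c = bmull hr a (bmull hlm b c);
  bmulrA : forall k l m n p q (hkl : (k + l)%N = p) (hlm : (l + m)%N = q)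
      (hl : (p + m)%N = n) (hr : (k + q)%N = n) U
      (a : bpart k U) (b : A l U) (c : A m U),
    bmulr hl (bmulr hkl a b) c = bmulr hr a (gmul hlm b c);
  bmullrA : forall k l m n p q (hkl : (k + l)%N = p) (hlm : (l + m)%N = q)
      (hl : (p + m)%N = n) (hr : (k + q)%N = n) U
      (a : A k U) (b : bpart l U) (c : A m U),
    bmulr hl (bmull hkl a b) c = bmull hr a (bmulr hlm b c);
  bmull1 : forall k (h : (0 + k)%N = k) U (a : bpart k U),
    bmull h (gone A U) a = a;
  bmulr1 : forall k (h : (k + 0)%N = k) U (a : bpart k U),
    bmulr h a (gone A U) = a }.

Section BimoduleTheory.
Variables (A : galgebra (X := X)) (M : gbimodule A).

Lemma bmullDl k l n (h : (k + l)%N = n) U (a b : A k U) (c : M l U) :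
  bmull h (a + b) c = bmull h a c + bmull h b c.
Proof. by have := bmull_linearl h 1 a b c; rewrite !scale1r. Qed.

Lemma bmullDr k l n (h : (k + l)%N = n) U (a : A k U) (b c : M l U) :
  bmull h a (b + c) = bmull h a b + bmull h a c.
Proof. by have := bmull_linearr h 1 a b c; rewrite !scale1r. Qed.

Lemma bmull0r k l n (h : (k + l)%N = n) U (a : A k U) :
  bmull h a (0 : M l U) = 0.
Proof. by apply: (addrI (bmull h a 0)); rewrite -bmullDr !addr0. Qed.

Lemma bmull0l k l n (h : (k + l)%N = n) U (m : M l U) :
  bmull h (0 : A k U) m = 0.
Proof. by apply: (addrI (bmull h 0 m)); rewrite -bmullDl !addr0. Qed.

Lemma bmullZl k l n (h : (k + l)%N = n) U f (a : A k U) (c : M l U) :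
  bmull h (f *: a) c = f *: bmull h a c.
Proof. by have := bmull_linearl h f a 0 c; rewrite bmull0l !addr0. Qed.

Lemma bmullZr k l n (h : (k + l)%N = n) U f (a : A k U) (c : M l U) :
  bmull h a (f *: c) = f *: bmull h a c.
Proof. by have := bmull_linearr h f a c 0; rewrite bmull0r !addr0. Qed.

Lemma bmulrDl k l n (h : (k + l)%N = n) U (a b : M k U) (c : A l U) :
  bmulr h (a + b) c = bmulr h a c + bmulr h b c.
Proof. by have := bmulr_linearl h 1 a b c; rewrite !scale1r. Qed.

Lemma bmulrDr k l n (h : (k + l)%N = n) U (a : M k U) (b c : A l U) :
  bmulr h a (b + c) = bmulr h a b + bmulr h a c.
Proof. by have := bmulr_linearr h 1 a b c; rewrite !scale1r. Qed.

Lemma bmulr0l k l n (h : (k + l)%N = n) U (c : A l U) :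
  bmulr h (0 : M k U) c = 0.
Proof. by apply: (addrI (bmulr h 0 c)); rewrite -bmulrDl !addr0. Qed.

Lemma bmulr0r k l n (h : (k + l)%N = n) U (m : M k U) :
  bmulr h m (0 : A l U) = 0.
Proof. by apply: (addrI (bmulr h m 0)); rewrite -bmulrDr !addr0. Qed.

Lemma bmulrZl k l n (h : (k + l)%N = n) U f (a : M k U) (c : A l U) :
  bmulr h (f *: a) c = f *: bmulr h a c.
Proof. by have := bmulr_linearl h f a 0 c; rewrite bmulr0l !addr0. Qed.

Lemma bmulrZr k l n (h : (k + l)%N = n) U f (a : M k U) (c : A l U) :
  bmulr h a (f *: c) = f *: bmulr h a c.
Proof. by have := bmulr_linearr h f a c 0; rewrite bmulr0r !addr0. Qed.

(* A derivation of O_X into M^0, the obstruction to the O_X-linearity of the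
   derivations of A into M. *)
Record anchor_map := AnchorMap {
  afun :> forall U, OX U -> M 0%N U;
  afunD : forall U (f g : OX U), afun (f + g) = afun f + afun g;
  afunM : forall U (f g : OX U), afun (f * g) = f *: afun g + g *: afun f;
  afun_res : forall U V (h : V `<=` U) (f : OX U),
    res h (afun f) = afun (Ores h f);
  afun_central : forall k (hl : (k + 0)%N = k) (hr : (0 + k)%N = k) U
    (f : OX U) (a : A k U), bmull hl a (afun f) = bmulr hr (afun f) a }.

Lemma afun1 (d : anchor_map) U : d U 1 = 0.
Proof.
by apply: (addrI (d U 1)); rewrite addr0 -{3}(mulr1 1) afunM scale1r.
Qed.

Program Definition anchor_map0 := @AnchorMap (fun U f => 0) _ _ _ _.
Next Obligation. by move=> *; rewrite addr0. Qed.
Next Obligation. by move=> *; rewrite !scaler0 addr0. Qed.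
Next Obligation. by move=> *; rewrite res0. Qed.
Next Obligation. by move=> *; rewrite bmull0r bmulr0l. Qed.

Section Extension.
(** [P] cuts a subalgebra out of A + M. The full sum has degree-0 part A^0 + M^0, whereas a
    [galgebra] must have O_X there; [P_degree0] restricts this part to the graph of d. The freedom
    in [P] also serves to prove induction principles. *)
Variables (d : anchor_map) (P : forall k U, A k U -> M k U -> Prop).
Hypothesis P0 : forall k U, P (0 : A k U) 0.
Hypothesis P1 : forall U, P (gone A U) 0.
Hypothesis P_add : forall k U (a b : A k U) m p,
  P a m -> P b p -> P (a + b) (m + p).
Hypothesis P_scale : forall k U f (a : A k U) m,
  P a m -> P (f *: a) (f *: m + bmulr (add0n k) (d U f) a).
Hypothesis P_res : forall k U V (h : V `<=` U) (a : A k U) m,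
  P a m -> P (res h a) (res h m).
Hypothesis P_local : forall k U I (V : I -> opens X)
  (h : forall i, V i `<=` U) (a : A k U) m, covers U V ->
  (forall i, P (res (h i) a) (res (h i) m)) -> P a m.
Hypothesis P_mul : forall k l n (h : (k + l)%N = n) U (a : A k U) (b : A l U)
  m p, P a m -> P b p -> P (gmul h a b) (bmulr h m b + bmull h a p).
Hypothesis P_degree0 : forall U (a : A 0%N U) m, P a m ->
  exists f, a = f *: gone A U /\ m = d U f.

(* A + M with M of square zero, where O_X acts through f |-> f + d f. *)
Record ext k U := Ext { ext1 : A k U; ext2 : M k U; extP : P ext1 ext2 }.

HB.instance Definition _ k U := gen_eqMixin (ext k U).
HB.instance Definition _ k U := gen_choiceMixin (ext k U).

Lemma ext_eq k U (x y : ext k U) :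
  ext1 x = ext1 y -> ext2 x = ext2 y -> x = y.
Proof.
case: x y => [a m am] [b p bp] /= ab mp; case: b / ab bp => bp.
by case: p / mp bp => bp; congr Ext; apply: Prop_irrelevance.
Qed.

Definition ext_zero k U := Ext (P0 k U).
Definition ext_add k U (x y : ext k U) := Ext (P_add (extP x) (extP y)).
Definition ext_scale k U f (x : ext k U) := Ext (P_scale f (extP x)).

Program Definition ext_opp k U (x : ext k U) :=
  @Ext k U (- ext1 x) (- ext2 x) _.
Next Obligation.
move=> k U x; have := P_scale (-1) (extP x).
suff -> : d U (-1) = 0 by rewrite bmulr0l addr0 !scaleN1r.
have /eqP := afun1 d U; rewrite -{1}(mul1r 1) -mulrNN afunM !scaleN1r -opprD.
rewrite oppr_eq0 => /eqP e.
have := afunD d 1 (-1 : OX U); rewrite subrr afun1 add0r => <-.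
by apply: (addrI (d U 0)); rewrite -afunD !addr0.
Qed.

Program Definition ext_zmodMixin k U :=
  @GRing.isZmodule.Build (ext k U) (ext_zero k U) (@ext_opp k U) (@ext_add k U)
    _ _ _ _.
Next Obligation. by move=> k U x y z; apply: ext_eq; apply: addrA. Qed.
Next Obligation. by move=> k U x y; apply: ext_eq; apply: addrC. Qed.
Next Obligation. by move=> k U x; apply: ext_eq; apply: add0r. Qed.
Next Obligation. by move=> k U x; apply: ext_eq; apply: addNr. Qed.
HB.instance Definition _ k U := ext_zmodMixin k U.

Program Definition ext_lmodMixin k U :=
  @GRing.Zmodule_isLmodule.Build (OX U) (ext k U) (@ext_scale k U) _ _ _ _.
Next Obligation.
move=> k U f g x; apply: ext_eq => /=; first by rewrite scalerA.
rewrite afunM bmulrDl !bmulrZl bmulrZr scalerDr scalerA -addrA.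
by congr (_ + _).
Qed.
Next Obligation.
by move=> k U x; apply: ext_eq; rewrite /= ?scale1r // afun1 bmulr0l addr0.
Qed.
Next Obligation.
by move=> k U f x y; apply: ext_eq; rewrite /= scalerDr ?bmulrDr // addrACA.
Qed.
Next Obligation.
move=> k U x f g; apply: ext_eq; rewrite /= scalerDl // afunD bmulrDl.
by rewrite addrACA.
Qed.
HB.instance Definition _ k U := ext_lmodMixin k U.

Definition ext_res k U V (h : V `<=` U) (x : ext k U) : ext k V :=
  Ext (P_res h (extP x)).

Program Definition ext_sheaf k : module_sheaf X :=
  @ModuleSheaf _ _ X (fun U => ext k U) (@ext_res k) _ _ _ _ _.
Next Obligation.
move=> k U V h f x y; apply: ext_eq => /=; first by rewrite resD resZ.
by rewrite !resD resZ bmulr_res afun_res.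
Qed.
Next Obligation. by move=> k U h x; apply: ext_eq; apply: res_id. Qed.
Next Obligation. by move=> k U V W h i l x; apply: ext_eq; apply: res_comp. Qed.
Next Obligation.
move=> k U I V h x y cov xy; apply: ext_eq.
  by apply: (sheaf_separated (h := h) cov) => i; have [] := xy i.
apply: (sheaf_separated (h := h) cov) => i.
exact: (congr1 (@ext2 k (V i)) (xy i)).
Qed.
Next Obligation.
move=> k U I V h x cov agree.
have [a aP] : exists a : A k U, forall i, res (h i) a = ext1 (x i).
  apply: sheaf_glue => // i i' W hi hi'.
  exact: (congr1 (@ext1 k W) (agree i i' W hi hi')).
have [m mP] : exists m : M k U, forall i, res (h i) m = ext2 (x i).
  apply: sheaf_glue => // i i' W hi hi'.
  exact: (congr1 (@ext2 k W) (agree i i' W hi hi')).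
have am : P a m.
  by apply: (P_local (h := h) cov) => i; rewrite aP mP; apply: extP.
by exists (Ext am) => i; apply: ext_eq => /=.
Qed.

Definition ext_mul k l n (h : (k + l)%N = n) U (x : ext k U) (y : ext l U) :=
  Ext (P_mul h (extP x) (extP y)).

Program Definition ext_algebra : galgebra (X := X) :=
  @GAlgebra _ _ X ext_sheaf (fun U => Ext (P1 U)) ext_mul _ _ _ _ _ _ _ _.
Next Obligation.
move=> k l n h U f x y z; apply: ext_eq => /=.
  by rewrite gmul_linearl.
rewrite !bmulrDl bmulrZl bmullDl bmullZl scalerDr.
rewrite (bmulrA _ h h (add0n n)) addrACA; congr (_ + _).
by rewrite addrAC.
Qed.
Next Obligation.
move=> k l n h U f x y z; apply: ext_eq => /=.
  by rewrite gmul_linearr.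
rewrite !bmullDr bmullZr bmulrDr bmulrZr scalerDr.
(* Linearity in the second factor: df stands between the two factors and has to be moved to the far
   left, past the first one, which is what [afun_central] permits. *)
rewrite -(bmullrA (addn0 k) _ h h).
rewrite (afun_central _ _ (add0n k)) (bmulrA _ h h (add0n n)).
by rewrite [LHS]addrACA; congr (_ + _); apply: addrA.
Qed.
Next Obligation. by move=> U V h; apply: ext_eq; rewrite /= ?gone_res ?res0. Qed.
Next Obligation.
move=> k l n h U V i x y; apply: ext_eq => /=; first exact: gmul_res.
by rewrite resD bmulr_res bmull_res.
Qed.
Next Obligation.
move=> k l m n p q hkl hlm hl hr U x y z; apply: ext_eq => /=; first exact: gmulA.
rewrite bmulrDl bmullDr (bmulrA _ hlm _ hr) (bmullrA _ hlm _ hr).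
by rewrite (bmullA _ hlm _ hr) addrA.
Qed.
Next Obligation.
move=> k h U x; apply: ext_eq; first exact: gmul1.
by rewrite /= bmulr0l bmull1 add0r.
Qed.
Next Obligation.
move=> k h U x; apply: ext_eq; first exact: gmulr1.
by rewrite /= bmull0r bmulr1 addr0.
Qed.
Next Obligation.
move=> U.
(* The multiples of the unit are the pairs (f, d f), so [P_degree0] says that they exhaust degree
   0. *)
have scaleE f (x : ext 0%N U) :
    x = f *: Ext (P1 U) <-> ext1 x = f *: gone A U /\ ext2 x = d U f.
  split=> [->|[x1 x2]]; first by rewrite /= scaler0 add0r bmulr1.
  by apply: ext_eq; rewrite //= scaler0 add0r bmulr1.
have /choice[g gP] (x : ext 0%N U) : exists f, x = f *: Ext (P1 U).
  by have [f fP] := P_degree0 (extP x); exists f; apply/scaleE.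
exists g => [f|x]; last by rewrite -gP.
by have /scaleE[/= /gone_inj] := gP (f *: Ext (P1 U)).
Qed.

Program Definition ext_proj : galgebra_hom ext_algebra A :=
  @GAlgebraHom _ _ X ext_algebra A
    (fun k => @SheafHom _ _ X (ext_sheaf k) (A k) (fun U => @ext1 k U) _ _) _ _.
Next Obligation. by []. Qed.
Next Obligation. by []. Qed.
Next Obligation. by []. Qed.
Next Obligation. by []. Qed.

(** The map s |-> (j s, delta s) is linear for the twisted action of O_X and squares to zero, hence
    extends to an algebra map g into the extension. The first component of g fixes the generators,
    so it is the identity; the second one is the derivation D. *)
Lemma ext_lift F (j : sheaf_hom F (A 1%N)) (delta : forall U, F U -> M 1%N U) :
  is_exterior_algebra j ->
  (forall U (s : F U), P (j U s) (delta U s)) ->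
  (forall U f (s t : F U), delta U (f *: s + t) =
     f *: delta U s + bmulr (add0n 1) (d U f) (j U s) + delta U t) ->
  (forall U V (h : V `<=` U) s, res h (delta U s) = delta V (res h s)) ->
  (forall (h : (1 + 1)%N = 2%N) U (s : F U),
     bmulr h (delta U s) (j U s) + bmull h (j U s) (delta U s) = 0) ->
  exists D : forall k U, A k U -> M k U,
    [/\ forall k U (a : A k U), P a (D k U a),
        forall k U f (a b : A k U), D k U (f *: a + b) =
          f *: D k U a + bmulr (add0n k) (d U f) a + D k U b,
        forall k U V (h : V `<=` U) (a : A k U), res h (D k U a) = D k V (res h a),
        forall k l n (h : (k + l)%N = n) U (a : A k U) (b : A l U),
          D n U (gmul h a b) = bmulr h (D k U a) b + bmull h a (D l U b)
      & forall U s, D 1%N U (j U s) = delta U s].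
Proof.
move=> A_ext Pj deltaL delta_res delta2.
pose jB U (s : F U) : ext_algebra 1%N U := Ext (Pj U s).
have jB_lin U f (s t : F U) : jB U (f *: s + t) = f *: jB U s + jB U t.
  by apply: ext_eq; [apply: shom_linear|apply: deltaL].
have jB_res U V (h : V `<=` U) (s : F U) : res h (jB U s) = jB V (res h s).
  by apply: ext_eq; [apply: shom_res|apply: delta_res].
have [|g [gj _]] := A_ext.2 ext_algebra (SheafHom jB_lin jB_res).
  by move=> h U s; apply: ext_eq; [apply: A_ext.1|apply: delta2].
have g1 k U (a : A k U) : ext1 (g k U a) = a.
  apply: (exterior_endo A_ext (g := galgebra_comp ext_proj g)) => V s /=.
  by rewrite gj.
exists (fun k U a => ext2 (g k U a)); split=> [k U a|k U f a b|k U V h a|k l n h U a b|U s].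
- by have := extP (g k U a); rewrite g1.
- by rewrite shom_linear /= g1.
- by rewrite -shom_res.
- by rewrite ghomM /= !g1.
- by rewrite gj.
Qed.

End Extension.
End BimoduleTheory.
End Bimodules.

(** * The bimodules 0, A[1], A[-1] and Hom(E, M), and induction on products *)

Section Examples.
Context {K : fieldType} {KO : set (set K)} {X : ringed_space KO}.
Implicit Types (U V W : opens X) (E F G : module_sheaf X).

Lemma free_sheaf0 U (s t : free_sheaf 0 U) : s = t.
Proof. by apply/funext => -[]. Qed.

Section Bimodules.
Variable A : galgebra (X := X).

Program Definition zero_bimodule : gbimodule A :=
  @GBimodule _ _ X A (fun=> free_sheaf 0) (fun _ _ _ _ _ _ _ => 0)
    (fun _ _ _ _ _ _ _ => 0) _ _ _ _ _ _ _ _ _ _ _.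
Solve Obligations with by move=> *; apply: free_sheaf0.

(* A[1], where the left action carries the Koszul sign: the bimodule
   derivations of A into it are the derivations of degree 1 of A. *)
Program Definition shift_up : gbimodule A :=
  @GBimodule _ _ X A (fun k => A k.+1)
    (fun k l n h U a m => (-1) ^+ k *: gmul (etrans (addnS k l) (congr1 S h)) a m)
    (fun k l n h U m a => gmul (congr1 S h : (k.+1 + l)%N = n.+1) m a)
    _ _ _ _ _ _ _ _ _ _ _.
Next Obligation.
by move=> * /=; rewrite gmul_linearl scalerDr !scalerA mulrC.
Qed.
Next Obligation.
by move=> * /=; rewrite gmul_linearr scalerDr !scalerA mulrC.
Qed.
Next Obligation. by move=> * /=; apply: gmul_linearl. Qed.
Next Obligation. by move=> * /=; apply: gmul_linearr. Qed.
Next Obligation.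
move=> k l n h U V i a b /=; rewrite resZ gmul_res; congr (_ *: _).
by apply: O_ext => u; elim: k {h a} => // k IH; rewrite !exprS !OmulE -IH.
Qed.
Next Obligation. by move=> * /=; apply: gmul_res. Qed.
Next Obligation.
move=> k l m n p q hkl hlm hl hr U a b c /=.
rewrite gmulZr scalerA -exprD hkl; congr (_ *: _).
exact: gmulA.
Qed.
Next Obligation. by move=> * /=; apply: gmulA. Qed.
Next Obligation.
move=> k l m n p q hkl hlm hl hr U a b c /=.
by rewrite gmulZl; congr (_ *: _); apply: gmulA.
Qed.
Next Obligation. by move=> k h U a /=; rewrite expr0 scale1r; apply: gmul1. Qed.
Next Obligation. by move=> k h U a; apply: gmulr1. Qed.

(* A[-1], whose part of degree 0 is the zero sheaf; the derivations of A into
   Hom(E, A[-1]) are the contractions. *)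
Definition down k : module_sheaf X := if k is k'.+1 then A k' else free_sheaf 0.

(** In the default branch, here and in [down_mulr], either the module element lies in the zero sheaf
    [down 0] or the equation between degrees is impossible. *)
Definition down_mull k l n : (k + l)%N = n ->
    forall U, A k U -> down l U -> down n U :=
  match l, n return
    (k + l)%N = n -> forall U, A k U -> down l U -> down n U with
  | l'.+1, n'.+1 => fun h U a m =>
      (-1) ^+ k *: gmul (succn_inj (etrans (esym (addnS k l')) h)) a m
  | _, _ => fun _ _ _ _ => 0
  end.

Definition down_mulr k l n : (k + l)%N = n ->
    forall U, down k U -> A l U -> down n U :=
  match k, n return
    (k + l)%N = n -> forall U, down k U -> A l U -> down n U with
  | k'.+1, n'.+1 => fun h U m a => gmul (succn_inj h) m a
  | _, _ => fun _ _ _ _ => 0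
  end.

Program Definition shift_down : gbimodule A :=
  @GBimodule _ _ X A down down_mull down_mulr _ _ _ _ _ _ _ _ _ _ _.
Next Obligation.
move=> k [|l] [|n] h U f a b c //=; rewrite ?scaler0 ?addr0 //.
by rewrite gmul_linearl scalerDr !scalerA mulrC.
Qed.
Next Obligation.
move=> k [|l] [|n] h U f a b c //=; rewrite ?scaler0 ?addr0 //.
by rewrite gmul_linearr scalerDr !scalerA mulrC.
Qed.
Next Obligation.
move=> [|k] l [|n] h U f a b c //=; rewrite ?scaler0 ?addr0 //.
exact: gmul_linearl.
Qed.
Next Obligation.
move=> [|k] l [|n] h U f a b c //=; rewrite ?scaler0 ?addr0 //.
exact: gmul_linearr.
Qed.
Next Obligation.
move=> k l [|n]; first by move=> *; apply: free_sheaf0.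
case: l => [|l] h U V i a b /=; first exact: (@res0 _ _ _ (A n)).
rewrite (@resZ _ _ _ (A n)) gmul_res; congr (_ *: _).
by apply: O_ext => u; elim: k {h a} => // k IH; rewrite !exprS !OmulE -IH.
Qed.
Next Obligation.
move=> k l [|n]; first by move=> *; apply: free_sheaf0.
case: k => [|k] h U V i a b /=; first exact: (@res0 _ _ _ (A n)).
exact: gmul_res.
Qed.
Next Obligation.
move=> k l [|m] [|n] p [|q] hkl hlm hl hr U a b c //=;
  rewrite ?gmul0r ?scaler0 //; first by move: (hlm); rewrite addnS.
rewrite gmulZr scalerA -exprD hkl; congr (_ *: _).
exact: (@gmulA _ _ _ A k l m n p q).
Qed.
Next Obligation.
move=> [|k] l m [|n] [|p] q hkl hlm hl hr U a b c //=; rewrite ?gmul0l //.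
exact: (@gmulA _ _ _ A k l m n p q).
Qed.
Next Obligation.
move=> k [|l] m [|n] [|p] [|q] hkl hlm hl hr U a b c //=;
  rewrite ?gmul0l ?gmul0r ?scaler0 //; first by move: (hkl); rewrite addnS.
by rewrite gmulZl; congr (_ *: _); apply: (@gmulA _ _ _ A k l m n p q).
Qed.
Next Obligation.
move=> [|k] h U a /=; first exact: free_sheaf0.
by rewrite expr0 scale1r; apply: gmul1.
Qed.
Next Obligation.
move=> [|k] h U a /=; first exact: free_sheaf0.
exact: gmulr1.
Qed.

Section HomBimodule.
Variables (E : module_sheaf X) (M : gbimodule A).

Program Definition hom_mull k l n (h : (k + l)%N = n) U (a : A k U)
    (m : hom_over E (M l) U) : hom_over E (M n) U :=
  @HomOver _ _ X E (M n) U
    (fun V i s => bmull h (res i a) (hom_fun m i s)) _ _.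
Next Obligation.
by move=> k l n h U a m V i f s t /=; rewrite hom_linear bmull_linearr.
Qed.
Next Obligation.
move=> k l n h U a m V W i i' i'' s /=.
by rewrite bmull_res (res_comp _ _ i'') (hom_res _ _ _ i'').
Qed.

Program Definition hom_mulr k l n (h : (k + l)%N = n) U
    (m : hom_over E (M k) U) (a : A l U) : hom_over E (M n) U :=
  @HomOver _ _ X E (M n) U
    (fun V i s => bmulr h (hom_fun m i s) (res i a)) _ _.
Next Obligation.
by move=> k l n h U a m V i f s t /=; rewrite hom_linear bmulr_linearl.
Qed.
Next Obligation.
move=> k l n h U a m V W i i' i'' s /=.
by rewrite bmulr_res (res_comp _ _ i'') (hom_res _ _ _ i'').
Qed.

Program Definition hom_bimodule : gbimodule A :=
  @GBimodule _ _ X A (fun k => hom_sheaf E (M k)) hom_mull hom_mulr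
    _ _ _ _ _ _ _ _ _ _ _.
Next Obligation.
move=> k l n h U f a b c; apply: hom_ext => V i s /=.
by rewrite res_linear bmull_linearl.
Qed.
Next Obligation.
move=> k l n h U f a b c; apply: hom_ext => V i s /=.
by rewrite bmull_linearr.
Qed.
Next Obligation.
move=> k l n h U f a b c; apply: hom_ext => V i s /=.
by rewrite bmulr_linearl.
Qed.
Next Obligation.
move=> k l n h U f a b c; apply: hom_ext => V i s /=.
by rewrite res_linear bmulr_linearr.
Qed.
Next Obligation.
move=> k l n h U V i a b; apply: hom_ext => W i' s /=.
by rewrite (res_comp _ _ (subset_trans i' i)).
Qed.
Next Obligation.
move=> k l n h U V i a b; apply: hom_ext => W i' s /=.
by rewrite (res_comp _ _ (subset_trans i' i)).
Qed.
Next Obligation.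
move=> k l m n p q hkl hlm hl hr U a b c; apply: hom_ext => V i s /=.
by rewrite gmul_res; apply: bmullA.
Qed.
Next Obligation.
move=> k l m n p q hkl hlm hl hr U a b c; apply: hom_ext => V i s /=.
by rewrite gmul_res; apply: bmulrA.
Qed.
Next Obligation.
move=> k l m n p q hkl hlm hl hr U a b c; apply: hom_ext => V i s /=.
exact: bmullrA.
Qed.
Next Obligation.
move=> k h U a; apply: hom_ext => V i s /=.
by rewrite gone_res bmull1.
Qed.
Next Obligation.
move=> k h U a; apply: hom_ext => V i s /=.
by rewrite gone_res bmulr1.
Qed.
End HomBimodule.
End Bimodules.

Section Exterior.
Variables (F : module_sheaf X) (A : galgebra (X := X)) (j : sheaf_hom F (A 1%N)).
Hypothesis A_ext : is_exterior_algebra j.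

(** The sections satisfying [P] form a subalgebra through which j factors. It is the extension of A
    by the zero bimodule cut out by [P], and [ext_lift] retracts A onto it. Locality of [P] makes it
    a sheaf. *)
Lemma exterior_ind (P : forall k U, A k U -> Prop) :
  (forall k U, P k U 0) ->
  (forall k U f (a b : A k U), P k U a -> P k U b -> P k U (f *: a + b)) ->
  (forall k U V (h : V `<=` U) (a : A k U), P k U a -> P k V (res h a)) ->
  (forall k U I (V : I -> opens X) (h : forall i, V i `<=` U) (a : A k U),
     covers U V -> (forall i, P k (V i) (res (h i) a)) -> P k U a) ->
  (forall U, P 0%N U (gone A U)) ->
  (forall k l n (h : (k + l)%N = n) U (a : A k U) (b : A l U),
     P k U a -> P l U b -> P n U (gmul h a b)) ->
  (forall U s, P 1%N U (j U s)) ->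
  forall k U (a : A k U), P k U a.
Proof.
move=> P_0 P_lin P_res P_loc P_1 P_mul P_j.
pose Q k U a (_ : zero_bimodule A k U) := P k U a.
have Q_add k U (a b : A k U) m p : Q k U a m -> Q k U b p -> Q k U (a + b) (m + p).
  by move=> Pa Pb; rewrite -[a]scale1r; apply: P_lin.
have Q_scale k U f (a : A k U) m : Q k U a m ->
    Q k U (f *: a) (f *: m + bmulr (add0n k) (anchor_map0 (zero_bimodule A) U f) a).
  by move=> Pa; rewrite -[f *: a]addr0; apply: P_lin.
have Q_degree0 U (a : A 0%N U) m : Q 0%N U a m -> exists f,
    a = f *: gone A U /\ m = anchor_map0 (zero_bimodule A) U f.
  by move=> _; have [f ->] := gdegree0 a; exists f; split=> //; apply: free_sheaf0.
have [||||D [PD _ _ _ _]] := @ext_lift _ _ X A (zero_bimodule A)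
  (anchor_map0 (zero_bimodule A)) Q
  (fun k U => P_0 k U) P_1 Q_add Q_scale (fun k U V h a m => P_res k U V h a)
  (fun k U I Vs h a m => P_loc k U I Vs h a)
  (fun k l n h U a b m p => P_mul k l n h U a b) Q_degree0 F j (fun U s => 0) A_ext.
- exact: P_j.
- by move=> *; apply: free_sheaf0.
- by move=> *; apply: free_sheaf0.
- by move=> *; apply: free_sheaf0.
- exact: PD.
Qed.
End Exterior.
End Examples.

(** * Induction on generators and odd derivations *)

Section Generators.
Context {K : fieldType} {KO : set (set K)} {X : ringed_space KO}.
Implicit Types (U V W : opens X) (E F G : module_sheaf X).

Lemma covers_opensI U W I (V : I -> opens X) : covers U V -> W `<=` U ->
  covers W (fun i => opensI (V i) W).
Proof. by move=> cov WU x Wx; have [i Vx] := cov x (WU x Wx); exists i. Qed.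

Lemma res_separated F U W I (V : I -> opens X) (s t : F W) :
  covers U V -> W `<=` U ->
  (forall i (Z : opens X) (hV : Z `<=` V i) (hW : Z `<=` W), res hW s = res hW t) -> s = t.
Proof.
move=> cov WU st.
have hW i : opensI (V i) W `<=` W by apply: subIsetr.
apply: (sheaf_separated (h := hW) (covers_opensI cov WU)) => i.
by apply: (st i); apply: subIsetl.
Qed.

Lemma Ores_sign U V (h : V `<=` U) k : Ores h ((-1) ^+ k) = (-1) ^+ k.
Proof. by apply: O_ext => u; elim: k => // k IH; rewrite !exprS !OmulE -IH. Qed.

Variables (F : module_sheaf X) (A : galgebra (X := X)) (j : sheaf_hom F (A 1%N)).
Hypothesis A_ext : is_exterior_algebra j.

(** Sections whose left multiplication preserves [P], called [Q] in the proof, form a subalgebra by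
    associativity and contain the generators, so they are everything; applying such a multiplication
    to the unit gives [P]. *)
Lemma exterior_ind_gen (P : forall k U, A k U -> Prop) :
  (forall k U f (a b : A k U), P k U a -> P k U b -> P k U (f *: a + b)) ->
  (forall k U V (h : V `<=` U) (a : A k U), P k U a -> P k V (res h a)) ->
  (forall k U I (V : I -> opens X) (h : forall i, V i `<=` U) (a : A k U),
     covers U V -> (forall i, P k (V i) (res (h i) a)) -> P k U a) ->
  (forall U, P 0%N U (gone A U)) ->
  (forall k U s (a : A k U), P k U a -> P k.+1 U (gmul (add1n k) (j U s) a)) ->
  forall k U (a : A k U), P k U a.
Proof.
move=> P_lin P_res P_loc P_1 P_j.
have P_0 k U : P k U 0.
  elim: k => [|k IH]; last by rewrite -(gmul0r (add1n k) (j U 0)); apply: P_j.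
  by rewrite -(addNr (gone A U)) -scaleN1r; apply: P_lin.
pose Q k U (a : A k U) := forall V (h : V `<=` U) l n (e : (k + l)%N = n)
  (b : A l V), P l V b -> P n V (gmul e (res h a) b).
suff QP k U (a : A k U) : Q k U a.
  move=> k U a; rewrite -[a](gmulr1 (addn0 k)) -(res_id (@subset_refl _ _) a).
  exact/QP/P_1.
move: k U a; apply: (exterior_ind A_ext).
- by move=> k U V h l n e b Pb; rewrite res0 gmul0l.
- move=> k U f a b Qa Qb V h l n e c Pc; rewrite res_linear gmul_linearl.
  by apply: P_lin; [apply: Qa|apply: Qb].
- move=> k U V h a Qa W i l n e b Pb.
  by rewrite (res_comp _ _ (subset_trans i h)); apply: Qa.
- move=> k U I V h a cov Qa W i l n e b Pb.
  have hW x : opensI (V x) W `<=` W by apply: subIsetr.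
  apply: (P_loc _ _ _ _ hW _ (covers_opensI cov i)) => x.
  have hV : opensI (V x) W `<=` V x by apply: subIsetl.
  have hU := subset_trans hV (h x).
  rewrite gmul_res (res_comp _ _ hU) -(res_comp (h x) hV hU).
  exact/Qa/P_res.
- by move=> U V h l n e; case: n / e => b Pb; rewrite gone_res gmul1.
- move=> k l n e U a b Qa Qb V h m p e' c Pc.
  have e1 : (k + (l + m))%N = p by rewrite addnA e.
  by rewrite gmul_res (gmulA _ erefl _ e1); apply/Qa/Qb.
- move=> U s V h l n e b Pb; rewrite shom_res.
  have en : l.+1 = n by rewrite -e.
  by case: n / en e => e; rewrite (gmul_irr e (add1n l)); apply: P_j.
Qed.

(** Polarisation of j(s)^2 = 0. *)
Lemma anticommutative_gen (h : (1 + 1)%N = 2) U s t :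
  gmul h (j U s) (j U t) = - gmul h (j U t) (j U s).
Proof.
have jD : j U (s + t) = j U s + j U t.
  by have := shom_linear j 1 s t; rewrite !scale1r.
have := A_ext.1 h U (s + t).
rewrite jD gmulDl !gmulDr !(A_ext.1 h) add0r addr0.
by move/eqP; rewrite addr_eq0 => /eqP.
Qed.

Lemma gmul_gen_comm k n (e1 : (k + 1)%N = n) (e2 : (1 + k)%N = n) U
    (a : A k U) t :
  gmul e1 a (j U t) = (-1) ^+ k *: gmul e2 (j U t) a.
Proof.
(* Quantifying over all smaller opens makes the property stable under restriction by construction;
   the later inductions use the same device. *)
pose P k U (a : A k U) := forall V (h : V `<=` U) t n
  (e1 : (k + 1)%N = n) (e2 : (1 + k)%N = n),
  gmul e1 (res h a) (j V t) = (-1) ^+ k *: gmul e2 (j V t) (res h a).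
suff Pa : P k U a.
  by have := Pa U (@subset_refl _ _) t n e1 e2; rewrite res_id.
move: k U a {n e1 e2 t}; apply: exterior_ind_gen.
- move=> k U f a b Pa Pb V h t n e1 e2.
  rewrite res_linear gmul_linearl gmul_linearr scalerDr !(Pa _ _ _ _ e1 e2).
  by rewrite !(Pb _ _ _ _ e1 e2) !scalerA mulrC.
- by move=> k U V h a Pa W i t n e1 e2; rewrite (res_comp _ _ (subset_trans i h)).
- move=> k U I V h a cov Pa W i t n e1 e2.
  apply: (res_separated cov i) => x Z hV hW.
  have hU := subset_trans hV (h x).
  rewrite resZ Ores_sign !gmul_res (res_comp _ _ hU) -(res_comp (h x) hV hU).
  by rewrite shom_res; apply: Pa.
- move=> U V h t n; case: n / => e2; rewrite gone_res gmul1 expr0 scale1r.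
  by rewrite (eq_irrelevance e2 (addn0 1)) gmulr1.
- move=> k U s a Pa V h t n e1 e2.
  have e3 : (k + 1)%N = k.+1 by rewrite addn1.
  have e4 : (1 + k.+1)%N = n by [].
  have e5 : (2 + k)%N = n by [].
  rewrite gmul_res (gmulA (add1n k) e3 e1 e4) (Pa _ _ _ _ e3 (add1n k)).
  rewrite gmulZr shom_res -(gmulA (erefl 2) (add1n k) e5 e4).
  rewrite anticommutative_gen gmulNl (gmulA _ (add1n k) _ e4) exprS mulN1r.
  by rewrite scaleNr scalerN; congr (- (_ *: _)); apply: gmul_irr.
Qed.

(** Induction on b, where a passes one generator at a time by [gmul_gen_comm]. *)
Lemma exterior_commutative : graded_commutative A.
Proof.
move=> k l n e1 e2 U a b.
pose P l U (b : A l U) := forall V (h : V `<=` U) k n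
  (e1 : (k + l)%N = n) (e2 : (l + k)%N = n) (a : A k V),
  gmul e1 a (res h b) = (-1) ^+ (k * l) *: gmul e2 (res h b) a.
suff Pb : P l U b.
  by have := Pb U (@subset_refl _ _) k n e1 e2 a; rewrite res_id.
move: l U b {k n e1 e2 a}; apply: exterior_ind_gen.
- move=> k U f a b Pa Pb V h l n e1 e2 c.
  rewrite res_linear gmul_linearl gmul_linearr scalerDr (Pa _ _ _ _ e1 e2).
  by rewrite (Pb _ _ _ _ e1 e2) !scalerA mulrC.
- by move=> k U V h a Pa W i t n e1 e2 b; rewrite (res_comp _ _ (subset_trans i h)).
- move=> k U I V h a cov Pa W i l n e1 e2 b.
  apply: (res_separated cov i) => x Z hV hW.
  have hU := subset_trans hV (h x).
  rewrite resZ Ores_sign !gmul_res (res_comp _ _ hU) -(res_comp (h x) hV hU).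
  exact: Pa.
- move=> U V h k n e1 e2; case: n / e2 e1 => e1 a.
  by rewrite gone_res gmul1 muln0 expr0 scale1r gmulr1.
- move=> l U s b Pb V h k n e1 e2 a.
  have e3 : (k + 1)%N = k.+1 by rewrite addn1.
  have e4 : (k.+1 + l)%N = n by rewrite -addn1 -addnA add1n.
  have e5 : (1 + (k + l))%N = n by rewrite add1n -addnS.
  have e6 : (l + k)%N = (k + l)%N by rewrite addnC.
  rewrite gmul_res -(gmulA e3 (add1n l) e4) shom_res (gmul_gen_comm _ (add1n k)).
  rewrite gmulZl (gmulA _ erefl _ e5) (Pb _ _ _ _ _ e6) gmulZr.
  by rewrite scalerA -exprD mulnS (gmulA _ e6 _ e5).
Qed.

End Generators.

(** * Existence of contractions *)

Section Contraction.
Context {K : fieldType} {KO : set (set K)} {X : ringed_space KO}.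
Implicit Types (U V W : opens X).
Variables (E : module_sheaf X) (A : galgebra (X := X)).
Variable j : sheaf_hom (dual E) (A 1%N).

(** Since there is no degree -1, contractions start in degree [k.+1] and [conM] speaks of two
    factors of positive degree; a factor of degree 0 is a scalar and falls under [con_linearr]. *)
Record is_contraction (con : forall k U, E U -> A k.+1 U -> A k U) : Prop :=
    IsContraction {
  con_linearl : forall k U f (D D' : E U) (a : A k.+1 U),
    con k U (f *: D + D') a = f *: con k U D a + con k U D' a;
  con_linearr : forall k U D f (a b : A k.+1 U),
    con k U D (f *: a + b) = f *: con k U D a + con k U D b;
  con_res : forall k U V (h : V `<=` U) D (a : A k.+1 U),
    res h (con k U D a) = con k V (res h D) (res h a);
  con_gen : forall U D s, con 0%N U D (j U s) = pairing s D *: gone A U;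
  conM : forall k l n (h : (k.+1 + l.+1)%N = n.+1) (h1 : (k + l.+1)%N = n)
    (h2 : (k.+1 + l)%N = n) U D (a : A k.+1 U) (b : A l.+1 U),
    con n U D (gmul h a b) =
      gmul h1 (con k U D a) b + (-1) ^+ k.+1 *: gmul h2 a (con l U D b) }.

(** The pairing gives an O_X-linear map from E^* to the degree-1 part of Hom(E, A[-1]), which
    [ext_lift] extends with the zero anchor map; evaluating the result at D is i_D. *)
Lemma contraction_exists :
  is_exterior_algebra j -> exists con, is_contraction con.
Proof.
move=> A_ext; pose M := hom_bimodule E (shift_down A).
have M0 U (m : M 0%N U) : m = 0.
  by apply: hom_ext => *; apply: free_sheaf0.
have delta_lin U (s : dual E U) V (h : V `<=` U) (f : OX V) (D D' : E V) :
    (hom_fun s h (f *: D + D') : OX V) *: gone A V =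
    f *: ((hom_fun s h D : OX V) *: gone A V) + (hom_fun s h D' : OX V) *: gone A V.
  by rewrite hom_linear scalerDl scalerA.
have delta_res U (s : dual E U) V W (h : V `<=` U) (k : W `<=` V) (l : W `<=` U)
    (D : E V) : res k ((hom_fun s h D : OX V) *: gone A V) =
    (hom_fun s l (res k D) : OX W) *: gone A W.
  by rewrite resZ gone_res -(hom_res s h k l).
pose delta U (s : dual E U) : M 1%N U := @HomOver _ _ X E (A 0%N) U
  (fun V h D => (hom_fun s h D : OX V) *: gone A V) (@delta_lin U s) (@delta_res U s).
have [|||||c [_ cL c_res cM cj]] := @ext_lift _ _ X A M
  (anchor_map0 M) (fun k U a m => True) (fun _ _ => I) (fun _ => I)
  (fun _ _ _ _ _ _ _ _ => I) (fun _ _ _ _ _ _ => I) (fun _ _ _ _ _ _ _ => I)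
  (fun _ _ _ _ _ _ _ _ _ => I) (fun _ _ _ _ _ _ _ _ _ _ _ => I) _
  (dual E) j delta A_ext.
- move=> U a m _; have [f ->] := gdegree0 a.
  by exists f; split=> //; rewrite [LHS]M0 [RHS]M0.
- by [].
- move=> U f s t; apply: hom_ext => V h D /=.
  by rewrite addr0 scalerDl scalerA.
- by move=> U V h s; apply: hom_ext.
(* Both terms are <s, D> s, with opposite signs because of the Koszul sign in the left action. *)
- move=> h U s; apply: hom_ext => V i D /=.
  rewrite gmulZl gmulZr expr1 scaleN1r.
  rewrite (eq_irrelevance (succn_inj h) (add0n 1)) gmul1.
  by rewrite (eq_irrelevance (succn_inj _) (addn0 1)) gmulr1 subrr.
exists (fun k U D a => hom_fun (c k.+1 U a) (@subset_refl _ _) D).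
split=> [k U f D D' a|k U D f a b|k U V h D a|U D s|k l n h h1 h2 U D a b].
- exact: hom_linear.
- by rewrite cL /= addr0 Ores_id.
- rewrite -c_res /= (hom_res _ _ _ h).
  by congr (hom_fun _ _ _); apply: Prop_irrelevance.
- by rewrite cj.
- by rewrite cM /= !res_id; congr (_ + _ *: _); apply: gmul_irr.
Qed.

End Contraction.

(** * Derivations of degree 1 with prescribed values on functions and generators *)

Section OddDerivation.
Context {K : fieldType} {KO : set (set K)} {X : ringed_space KO}.
Implicit Types (U V W : opens X).
Variables (F : module_sheaf X) (A : galgebra (X := X)) (j : sheaf_hom F (A 1%N)).
Hypothesis A_ext : is_exterior_algebra j.

(** A differential up to K-linearity and d^2 = 0, which are established separately. In
    [oder_linear], df appears as the value of d on f times the unit. *)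
Record is_odd_derivation (d : forall k U, A k U -> A k.+1 U) : Prop :=
    IsOddDerivation {
  oder_linear : forall k U f (a b : A k U), d k U (f *: a + b) =
    gmul (add1n k) (d 0%N U (f *: gone A U)) a + f *: d k U a + d k U b;
  oder_res : forall k U V (h : V `<=` U) (a : A k U), res h (d k U a) = d k V (res h a);
  oder_leibniz : forall k l n (h : (k + l)%N = n) (h1 : (k.+1 + l)%N = n.+1)
      (h2 : (k + l.+1)%N = n.+1) U (a : A k U) (b : A l U),
    d n U (gmul h a b) =
      gmul h1 (d k U a) b + (-1) ^+ k *: gmul h2 a (d l U b) }.

Lemma odd_derivation_exists (d0 : forall U, OX U -> A 1%N U)
    (delta : forall U, F U -> A 2 U) :
  (forall U f g, d0 U (f + g) = d0 U f + d0 U g) ->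
  (forall U f g, d0 U (f * g) = f *: d0 U g + g *: d0 U f) ->
  (forall U V (h : V `<=` U) f, res h (d0 U f) = d0 V (Ores h f)) ->
  (forall U f s t, delta U (f *: s + t) =
     gmul (add1n 1) (d0 U f) (j U s) + f *: delta U s + delta U t) ->
  (forall U V (h : V `<=` U) s, res h (delta U s) = delta V (res h s)) ->
  exists d, [/\ is_odd_derivation d,
    forall U f, d 0%N U (f *: gone A U) = d0 U f
    & forall U s, d 1%N U (j U s) = delta U s].
Proof.
move=> d0D d0M d0_res deltaL delta_res.
pose M := shift_up A.
(* The sign (-1)^k of the left action cancels the one from moving the 1-form df past a. *)
have d0C k (hl : (k + 0)%N = k) (hr : (0 + k)%N = k) U (f : OX U) (a : A k U) :
    bmull hl a (d0 U f : M 0%N U) = bmulr hr (d0 U f : M 0%N U) a.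
  have e : (1 + k)%N = k.+1 by [].
  rewrite /= (exterior_commutative A_ext _ e) muln1 scalerA -exprD addnn -mul2n.
  by rewrite exprM sqrrN expr1n expr1n scale1r; apply: gmul_irr.
pose am := @AnchorMap _ _ X A M d0 d0D d0M d0_res d0C.
(* In degree 0 the extension is cut down to the graph of d0; in positive degree it is all of A +
   A[1]. *)
pose P k : forall U, A k U -> M k U -> Prop :=
  match k return forall U, A k U -> M k U -> Prop with
  | 0 => fun U a m => exists f, a = f *: gone A U /\ m = d0 U f
  | _ => fun U a m => True
  end.
have d01 U : d0 U 1 = 0 := afun1 am U.
have P0 k U : P k U 0 0.
  case: k => //=; exists 0; rewrite scale0r; split=> //.
  by apply: (addrI (d0 U 0)); rewrite -d0D !addr0.
have P1 U : P 0%N U (gone A U) 0 by exists 1; rewrite scale1r d01.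
have P_add k U (a b : A k U) m p : P k U a m -> P k U b p -> P k U (a + b) (m + p).
  case: k a b m p => //= a b m p [f [-> ->]] [g [-> ->]].
  by exists (f + g); rewrite scalerDl d0D.
have P_scale k U f (a : A k U) m : P k U a m ->
    P k U (f *: a) (f *: m + bmulr (add0n k) (am U f) a).
  case: k a m => //= a m [g [-> ->]]; exists (f * g); rewrite scalerA; split=> //.
  rewrite d0M gmulZr; congr (_ + _ *: _).
  by rewrite (eq_irrelevance (congr1 _ _) (addn0 1)) gmulr1.
have P_res k U V (h : V `<=` U) (a : A k U) m : P k U a m ->
    P k V (res h a) (res h m).
  case: k a m => //= a m [g [-> ->]]; exists (Ores h g).
  by rewrite resZ gone_res d0_res.
have P_loc k U I (Vs : I -> opens X) (h : forall i, Vs i `<=` U) (a : A k U) m :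
    covers U Vs -> (forall i, P k (Vs i) (res (h i) a) (res (h i) m)) -> P k U a m.
  case: k a m => //= a m cov Pi; have [f af] := gdegree0 a; exists f; split=> //.
  apply: (sheaf_separated (h := h) cov) => i; have [g [ag ->]] := Pi i.
  rewrite d0_res; congr (d0 _ _); apply: (gone_inj (A := A)).
  by rewrite -ag af resZ gone_res.
have P_mul k l n (h : (k + l)%N = n) U (a : A k U) (b : A l U) (m : M k U) (p : M l U) :
    P k U a m -> P l U b p -> P n U (gmul h a b) (bmulr h m b + bmull h a p).
  case: k a m h => [|k] a m; case: l b p => [|l] b p; case: n => [|n] h //=.
  move=> [f [-> ->]] [g [-> ->]]; exists (f * g).
  rewrite gmulZl !gmulZr (eq_irrelevance h (add0n 0)) gmul1 scalerA; split=> //.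
  rewrite (eq_irrelevance (congr1 _ _) (addn0 1)) gmulr1 gmulZl expr0 scale1r.
  rewrite (eq_irrelevance (etrans _ _) (add0n 1)) gmul1 d0M.
  exact: addrC.
have P_degree0 U (a : A 0%N U) (m : M 0%N U) : P 0%N U a m ->
    exists f, a = f *: gone A U /\ m = am U f by [].
have [||||d [Pd dL d_res dM dj]] := @ext_lift _ _ X A M am P P0 P1
  P_add P_scale P_res P_loc P_mul P_degree0 F j delta A_ext.
- by [].
- move=> U f s t; rewrite deltaL /=; congr (_ + _); rewrite addrC.
  by congr (_ + _); apply: gmul_irr.
- exact: delta_res.
(* The square of (j s, delta s) has second component (delta s) s - s (delta s), which vanishes as
   delta s has even degree. *)
- move=> h U s /=; have e : (1 + 2)%N = 3 by [].
  rewrite (exterior_commutative A_ext _ e) expr1 scaleN1r.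
  rewrite muln1 sqrrN expr1n scale1r; apply/eqP; rewrite subr_eq0.
  exact/eqP/gmul_irr.
have d1 U : d 0%N U (gone A U) = 0.
  have [f []] := Pd 0%N U (gone A U).
  by rewrite -{1}[gone A U]scale1r => /(gone_inj (A := A)) <- ->.
have d0E U f : d 0%N U (f *: gone A U) = d0 U f.
  have := dL 0%N U f (gone A U) 0; rewrite !addr0 => ->.
  have -> : d 0%N U 0 = 0.
    have := dL 0%N U 1 0 0; rewrite scaler0 addr0 scale1r /= gmul0r addr0 => e.
    by apply: (addrI (d 0%N U 0)); rewrite addr0 -e.
  rewrite d1 scaler0 add0r addr0 /=.
  by rewrite (eq_irrelevance (congr1 _ _) (addn0 1)) gmulr1.
exists d; split=> //; split=> [k U f a b|k U V h a|k l n h h1 h2 U a b].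
- rewrite dL d0E /=; congr (_ + _); rewrite addrC; congr (_ + _).
  exact: gmul_irr.
- exact: d_res.
- by rewrite dM /=; congr (_ + _ *: _); apply: gmul_irr.
Qed.

End OddDerivation.

(** * Local frames *)

Section Frames.
Context {K : fieldType} {KO : set (set K)} {X : ringed_space KO}.
Implicit Types (U V W : opens X) (E F G : module_sheaf X).

Section Linear.
Variables (F G : module_sheaf X).

Lemma shomD (g : sheaf_hom F G) U (s t : F U) : g U (s + t) = g U s + g U t.
Proof. by have := shom_linear g 1 s t; rewrite !scale1r. Qed.

Lemma shom0 (g : sheaf_hom F G) U : g U 0 = 0.
Proof. by apply: (addrI (g U 0)); rewrite -shomD !addr0. Qed.

Lemma shomZ (g : sheaf_hom F G) U f (s : F U) : g U (f *: s) = f *: g U s.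
Proof. by have := shom_linear g f s 0; rewrite shom0 !addr0. Qed.

Lemma shomB (g : sheaf_hom F G) U (s t : F U) : g U (s - t) = g U s - g U t.
Proof. by rewrite shomD -scaleN1r shomZ scaleN1r. Qed.

Lemma shom_sum (g : sheaf_hom F G) U n (s : 'I_n -> F U) :
  g U (\sum_i s i) = \sum_i g U (s i).
Proof. by elim/big_rec2: _ => [|i x y _ <-]; rewrite ?shom0 ?shomD. Qed.

Lemma homD U (a : hom_over F G U) V (h : V `<=` U) (s t : F V) :
  hom_fun a h (s + t) = hom_fun a h s + hom_fun a h t.
Proof. by have := hom_linear a h 1 s t; rewrite !scale1r. Qed.

Lemma hom0 U (a : hom_over F G U) V (h : V `<=` U) : hom_fun a h 0 = 0.
Proof. by apply: (addrI (hom_fun a h 0)); rewrite -homD !addr0. Qed.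

Lemma homZ U (a : hom_over F G U) V (h : V `<=` U) f (s : F V) :
  hom_fun a h (f *: s) = f *: hom_fun a h s.
Proof. by have := hom_linear a h f s 0; rewrite hom0 !addr0. Qed.

Lemma hom_sum U (a : hom_over F G U) V (h : V `<=` U) n (s : 'I_n -> F V) :
  hom_fun a h (\sum_i s i) = \sum_i hom_fun a h (s i).
Proof. by elim/big_rec2: _ => [|i x y _ <-]; rewrite ?hom0 ?homD. Qed.

Lemma res_sum U V (h : V `<=` U) n (s : 'I_n -> F U) :
  res h (\sum_i s i) = \sum_i res h (s i).
Proof. by elim/big_rec2: _ => [|i x y _ <-]; rewrite ?res0 ?resD. Qed.
End Linear.

Section Pairing.
Variable F : module_sheaf X.

Lemma hom_funE U (a : dual F U) V (h : V `<=` U) s :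
  hom_fun a h s = pairing (res h a) s.
Proof. by rewrite /pairing /=; congr (hom_fun a _ s); apply: Prop_irrelevance. Qed.

Lemma pairing_res U V (h : V `<=` U) (a : dual F U) s :
  Ores h (pairing a s) = pairing (res h a) (res h s).
Proof. by rewrite -hom_funE -(hom_res a (@subset_refl _ _) h h). Qed.

Lemma pairing_linearl U f (a b : dual F U) s :
  pairing (f *: a + b) s = f * pairing a s + pairing b s.
Proof. by rewrite /pairing /= Ores_id. Qed.

Lemma pairing_linearr U f (a : dual F U) s t :
  pairing a (f *: s + t) = f * pairing a s + pairing a t.
Proof. exact: (hom_linear a (@subset_refl _ U) f s t). Qed.

Lemma dual_ext U (a b : dual F U) :
  (forall V (h : V `<=` U) s, pairing (res h a) s = pairing (res h b) s) -> a = b.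
Proof. by move=> ab; apply: hom_ext => V h s; rewrite !hom_funE ab. Qed.

Lemma pairing_suml U n (a : 'I_n -> dual F U) s :
  pairing (\sum_i a i) s = \sum_i pairing (a i) s.
Proof. by elim/big_rec2: _ => // i x y _ <-. Qed.

Lemma pairingZl U f (a : dual F U) s : pairing (f *: a) s = f * pairing a s.
Proof. by rewrite -[f *: a]addr0 pairing_linearl addr0. Qed.

Lemma pairingZr U f (a : dual F U) s : pairing a (f *: s) = f * pairing a s.
Proof. exact: (homZ a (@subset_refl _ U) f s). Qed.

Lemma pairingDr U (a : dual F U) s t : pairing a (s + t) = pairing a s + pairing a t.
Proof. exact: (homD a (@subset_refl _ U) s t). Qed.
End Pairing.

(* [e] generates F over U and [x] gives coefficients; [x] need not be
   biorthogonal to [e]. *)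
Definition is_frame F U n (e : 'I_n -> F U) (x : 'I_n -> dual F U) :=
  forall V (h : V `<=` U) s, s = \sum_i pairing (res h (x i)) s *: res h (e i).

Definition framed F U := exists n (e : 'I_n -> F U) (x : 'I_n -> dual F U), is_frame e x.

Lemma is_frame_res F U n (e : 'I_n -> F U) x V (h : V `<=` U) :
  is_frame e x -> is_frame (fun i => res h (e i)) (fun i => res h (x i)).
Proof.
move=> ex W k s; rewrite {1}(ex W (subset_trans k h) s).
by apply: eq_bigr => i _; rewrite !(res_comp _ _ (subset_trans k h)).
Qed.

Lemma framed_res F U V : V `<=` U -> framed F U -> framed F V.
Proof.
move=> h [n [e [x ex]]]; exists n, (fun i => res h (e i)), (fun i => res h (x i)).
exact: is_frame_res.
Qed.

Lemma frame_expand F U n (e : 'I_n -> F U) x s :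
  is_frame e x -> s = \sum_i pairing (x i) s *: e i.
Proof.
move=> ex; rewrite {1}(ex U (@subset_refl _ _) s).
by apply: eq_bigr => i _; rewrite !res_id.
Qed.

Lemma dual_frame_expand F U n (e : 'I_n -> F U) x (a : dual F U) :
  is_frame e x -> a = \sum_i pairing a (e i) *: x i.
Proof.
move=> ex; apply: dual_ext => V h s; rewrite {1}(ex V h s).
rewrite res_sum pairing_suml [LHS]hom_sum; apply: eq_bigr => i _.
by rewrite resZ pairingZl homZ -[hom_fun _ _ _]/(pairing _ _) -pairing_res mulrC.
Qed.

(** The frame is the image of the standard basis, with the coordinates of the inverse isomorphism as
    coefficients. *)
Lemma free_on_framed F n U : free_on F n U -> framed F U.
Proof.
move=> [a [b [_ ba]]].
pose e (i : 'I_n) : F U := hom_fun a (@subset_refl _ U) (fun k => (k == i)%:R).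
have x_lin i V (h : V `<=` U) f (s t : F V) :
    hom_fun b h (f *: s + t) i = f * hom_fun b h s i + hom_fun b h t i.
  by rewrite hom_linear.
have x_res i V W (h : V `<=` U) (k : W `<=` V) (l : W `<=` U) (s : F V) :
    Ores k (hom_fun b h s i) = hom_fun b l (res k s) i.
  by rewrite -(hom_res b h k l).
pose x i : dual F U :=
  @HomOver _ _ X F O_sheaf U (fun V h s => hom_fun b h s i) (x_lin i) (x_res i).
exists n, e, x => V h s; rewrite -{1}(ba V h s).
pose d i : free_sheaf n V := fun k => (k == i)%:R.
have -> : hom_fun b h s = \sum_i hom_fun b h s i *: d i.
  apply/funext => k; set c := hom_fun b h s.
  have -> : (\sum_i c i *: d i) k = \sum_i c i * d i k.
    by elim/big_rec2: _ => // i y z _ <-.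
  rewrite (bigD1 k) //= /d eqxx mulr1 big1 ?addr0 // => i ik.
  by rewrite eq_sym (negPf ik) mulr0.
rewrite hom_sum; apply: eq_bigr => i _; rewrite homZ -hom_funE; congr (_ *: _).
rewrite /e (hom_res _ _ _ h); congr (hom_fun _ _ _).
by apply/funext => k; rewrite /d /=; case: (k == i); apply: O_ext.
Qed.

Section LocallyFree.
Variable F : module_sheaf X.
Hypothesis F_free : locally_free_finite F.

Lemma framed_cover U : exists I (V : I -> opens X),
  covers U V /\ forall i, V i `<=` U /\ framed F (V i).
Proof.
exists {V : opens X | V `<=` U /\ framed F V}, (@proj1_sig _ _).
split=> [x Ux|[V []] //]; have [V [n [Vx /free_on_framed fV]]] := F_free x.
have VU : opensI V U `<=` V by apply: subIsetl.
by exists (exist _ (opensI V U) (conj (@subIsetr _ V U) (framed_res VU fV))).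
Qed.

Lemma framed_separated G U (s t : G U) :
  (forall V (h : V `<=` U), framed F V -> res h s = res h t) -> s = t.
Proof.
move=> st; have [I [V [cov VP]]] := framed_cover U.
by apply: (sheaf_separated (h := fun i => (VP i).1) cov) => i; apply: st; have [] := VP i.
Qed.

(** A section characterised by a local property [R] exists once it exists where F has a frame:
    uniqueness makes the local solutions agree on overlaps. *)
Lemma framed_glue G U (R : forall V, V `<=` U -> G V -> Prop) :
  (forall V h t t', R V h t -> R V h t' -> t = t') ->
  (forall V W h (k : W `<=` V) l t, R V h t -> R W l (res k t)) ->
  (forall V h t, (forall W (k : W `<=` V) l, framed F W -> R W l (res k t)) -> R V h t) ->
  (forall V h, framed F V -> exists t, R V h t) ->
  exists t, R U (@subset_refl _ U) t.
Proof.
move=> R_uniq R_res R_loc R_ex; have [I [V [cov VP]]] := framed_cover U.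
have s_ex i : exists s : G (V i), R _ (VP i).1 s.
  by apply: R_ex; have [] := VP i.
pose s i := projT1 (cid (s_ex i)).
have sP i : R _ (VP i).1 (s i) := projT2 (cid (s_ex i)).
have [t tP] : exists t : G U, forall i, res (VP i).1 t = s i.
  apply: sheaf_glue => // i i' W hi hi'.
  have WU := subset_trans hi (VP i).1.
  exact: (R_uniq W WU _ _ (R_res _ _ _ _ _ _ (sP i)) (R_res _ _ _ _ _ _ (sP i'))).
(* [R_loc] ranges over all framed W, not only over the members of the cover; on such a W the glued
   section equals the solution w over W, again by uniqueness. *)
exists t; apply: R_loc => W k l fW.
have [w wP] := R_ex W k fW.
suff -> : res k t = w by rewrite (Prop_irrelevance l k).
apply: (res_separated cov k) => i Z hV hW.
have ZU := subset_trans hV (VP i).1.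
rewrite (res_comp _ _ ZU) -(res_comp (VP i).1 hV) tP.
exact: (R_uniq Z ZU _ _ (R_res _ _ _ _ _ _ (sP i)) (R_res _ _ _ _ _ _ wP)).
Qed.

Lemma dual_separated U (s t : F U) :
  (forall V (h : V `<=` U) (a : dual F V),
     pairing a (res h s) = pairing a (res h t)) -> s = t.
Proof.
move=> st; apply: framed_separated => V h [n [e [x ex]]].
rewrite (frame_expand (res h s) ex) (frame_expand (res h t) ex).
by apply: eq_bigr => i _; rewrite st.
Qed.

(** Reflexivity of F. Over a frame the section is the sum of l(x_i) e_i, and [dual_separated] gives
    the uniqueness needed to glue. *)
Lemma bidual_surjective U (l : forall V, V `<=` U -> dual F V -> OX V) :
  (forall V h f a b, l V h (f *: a + b) = f * l V h a + l V h b) ->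
  (forall V W h (k : W `<=` V) h' a, Ores k (l V h a) = l W h' (res k a)) ->
  exists s : F U, forall V h a, l V h a = pairing a (res h s).
Proof.
move=> l_lin l_res.
have l_0 V h : l V h 0 = 0.
  apply: (addrI (l V h 0)); have := l_lin V h 1 0 0.
  by rewrite scale1r mul1r !addr0.
have l_sum V h n (f : 'I_n -> OX V) a :
    l V h (\sum_i f i *: a i) = \sum_i f i * l V h (a i).
  by elim/big_rec2: _ => [|i x y _ <-]; rewrite ?l_0 ?l_lin.
pose R V (h : V `<=` U) (s : F V) := forall W (k : W `<=` V) l' a,
  l W l' a = pairing a (res k s).
have [s sP] : exists s, R U (@subset_refl _ U) s; last first.
  by exists s => V h a; apply: sP.
apply: framed_glue => [V h s t sP tP|V W h k h' s sP Z m h'' a|V h s sP W k h' a|V h].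
- apply: dual_separated => W k a.
  by rewrite -(sP _ k (subset_trans k h)) -(tP _ k (subset_trans k h)).
- by rewrite (res_comp _ _ (subset_trans m k)) -(sP _ _ h'').
- apply: (framed_separated (G := O_sheaf)) => Z m fZ /=.
  rewrite (l_res _ _ _ _ (subset_trans m h')) pairing_res (res_comp _ _ (subset_trans m k)).
  have := sP Z (subset_trans m k) (subset_trans m h') fZ Z (@subset_refl _ _)
    (subset_trans m h') (res m a).
  by rewrite res_id.
- move=> [n [e [x ex]]]; exists (\sum_i l V h (x i) *: e i) => W k h' a.
  rewrite {1}(dual_frame_expand a (is_frame_res k ex)) l_sum res_sum [RHS]hom_sum.
  apply: eq_bigr => i _.
  by rewrite resZ homZ (l_res _ _ _ _ h') mulrC.
Qed.
End LocallyFree.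
End Frames.

(** * Contractions *)

Section DegreeZero.
Context {K : fieldType} {KO : set (set K)} {X : ringed_space KO}.
Implicit Types (U V W : opens X).
Variable A : galgebra (X := X).

Definition gcoef U (a : A 0%N U) : OX U := projT1 (cid (gdegree0 a)).

Lemma gcoefE U (a : A 0%N U) : a = gcoef a *: gone A U.
Proof. exact: projT2 (cid (gdegree0 a)). Qed.

Lemma gcoefK U f : gcoef (f *: gone A U) = f.
Proof. by apply: (gone_inj (A := A)); rewrite -gcoefE. Qed.

Lemma gcoef_linear U f (a b : A 0%N U) : gcoef (f *: a + b) = f * gcoef a + gcoef b.
Proof.
by apply: (gone_inj (A := A)); rewrite -gcoefE scalerDl -scalerA -!gcoefE.
Qed.

Lemma gcoefD U (a b : A 0%N U) : gcoef (a + b) = gcoef a + gcoef b.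
Proof. by rewrite -[a]scale1r gcoef_linear mul1r scale1r. Qed.

Lemma gcoefB U (a b : A 0%N U) : gcoef (a - b) = gcoef a - gcoef b.
Proof. by rewrite addrC -scaleN1r gcoef_linear mulN1r addrC. Qed.

Lemma gcoefZ U f (a : A 0%N U) : gcoef (f *: a) = f * gcoef a.
Proof. by apply: (gone_inj (A := A)); rewrite -gcoefE -scalerA -gcoefE. Qed.

Lemma gcoefN U (a : A 0%N U) : gcoef (- a) = - gcoef a.
Proof. by rewrite -scaleN1r gcoefZ mulN1r. Qed.

Lemma gcoef_res U V (h : V `<=` U) (a : A 0%N U) : Ores h (gcoef a) = gcoef (res h a).
Proof.
by apply: (gone_inj (A := A)); rewrite -gcoefE -(gone_res A h) -resZ -gcoefE.
Qed.

Lemma OX_natr_unit U n : [pchar K] =i pred0 -> exists c : OX U, c * n.+1%:R = 1.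
Proof.
move=> /pcharf0P K0; exists (Ocst U n.+1%:R^-1); apply: O_ext => u.
have natE m : (m%:R : OX U) u = m%:R.
  by elim: m => // m IH; rewrite !mulrS OaddE IH.
by rewrite OmulE natE OcstE OoneE mulVf // K0.
Qed.
End DegreeZero.

Section ContractionTheory.
Context {K : fieldType} {KO : set (set K)} {X : ringed_space KO}.
Implicit Types (U V W : opens X).
Variables (E : module_sheaf X) (A : galgebra (X := X)).
Variable j : sheaf_hom (dual E) (A 1%N).
Hypothesis A_ext : is_exterior_algebra j.
Variable con : forall k U, E U -> A k.+1 U -> A k U.
Hypothesis conP : is_contraction j (@con).

Section Linearity.
Variables (k : nat) (U : opens X).
Implicit Types (D : E U) (a b : A k.+1 U).

Lemma conDr D a b : con D (a + b) = con D a + con D b.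
Proof. by have := con_linearr conP D 1 a b; rewrite !scale1r. Qed.

Lemma con0r D : con D (0 : A k.+1 U) = 0.
Proof. by apply: (addrI (con D 0)); rewrite -conDr !addr0. Qed.

Lemma conZr D f a : con D (f *: a) = f *: con D a.
Proof. by have := con_linearr conP D f a 0; rewrite con0r !addr0. Qed.

Lemma conBr D a b : con D (a - b) = con D a - con D b.
Proof. by rewrite -scaleN1r conDr conZr scaleN1r. Qed.

Lemma con_sumr D n (a : 'I_n -> A k.+1 U) : con D (\sum_i a i) = \sum_i con D (a i).
Proof. by elim/big_rec2: _ => [|i x y _ <-]; rewrite ?con0r ?conDr. Qed.

Lemma conDl D D' a : con (D + D') a = con D a + con D' a.
Proof. by have := con_linearl conP 1 D D' a; rewrite !scale1r. Qed.

Lemma con0l a : con 0 a = 0.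
Proof. by apply: (addrI (con 0 a)); rewrite -conDl !addr0. Qed.

Lemma conZl f D a : con (f *: D) a = f *: con D a.
Proof. by have := con_linearl conP f D 0 a; rewrite con0l !addr0. Qed.

Lemma conBl D D' a : con (D - D') a = con D a - con D' a.
Proof. by rewrite -scaleN1r conDl conZl scaleN1r. Qed.
End Linearity.

Lemma conM1 k U D (w : A 1%N U) (a : A k.+1 U) :
  con D (gmul (add1n k.+1) w a) =
    gmul (add0n k.+1) (con D w) a - gmul (add1n k) w (con D a).
Proof.
by rewrite (conM conP _ (add0n k.+1) (add1n k)) expr1 scaleN1r.
Qed.

Lemma conM10 U D (w : A 1%N U) (a : A 0%N U) :
  con D (gmul (add1n 0) w a) = gcoef a *: con D w.
Proof.
rewrite {1}(gcoefE a) gmulZr conZr (gmul_irr (add1n 0) (addn0 1)).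
by rewrite gmulr1.
Qed.

Lemma gmul0E k U (a : A 0%N U) (b : A k U) : gmul (add0n k) a b = gcoef a *: b.
Proof. by rewrite {1}(gcoefE a) gmulZl gmul1. Qed.

Lemma gmulE0 U (w : A 1%N U) (a : A 0%N U) : gmul (add1n 0) w a = gcoef a *: w.
Proof.
by rewrite {1}(gcoefE a) gmulZr (gmul_irr (add1n 0) (addn0 1)) gmulr1.
Qed.

Lemma con_genM k U D s (a : A k.+1 U) :
  con D (gmul (add1n k.+1) (j U s) a) =
    pairing s D *: a - gmul (add1n k) (j U s) (con D a).
Proof. by rewrite conM1 (con_gen conP) gmul0E gcoefK. Qed.

(** Euler's identity, by induction on a product s a. The terms <s, e_i> x_i a add up to s a; in the
    others, moving x_i past s absorbs the sign of the contraction and leaves s times the sum for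
    a. *)
Lemma sum_gen_con k U (a : A k.+1 U) n (e : 'I_n -> E U) x : is_frame e x ->
  \sum_i gmul (add1n k) (j U (x i)) (con (e i) a) = k.+1%:R *: a.
Proof.
pose P k : forall U, A k U -> Prop := match k return forall U, A k U -> Prop with
  | 0 => fun U a => True
  | k'.+1 => fun U a => forall V (h : V `<=` U) n (e : 'I_n -> E V) x, is_frame e x ->
      \sum_i gmul (add1n k') (j V (x i)) (con (e i) (res h a)) = k'.+1%:R *: res h a
  end.
suff Pa k' U' a' : P k' U' a'.
  by move=> /(Pa k.+1 U a U (@subset_refl _ U)); rewrite res_id.
move: k' U' a' => {k U a n e x}.
apply: (exterior_ind_gen A_ext).
- case=> // k U f a b Pa Pb V h n e x ex.
  rewrite res_linear scalerDr scalerA mulrC -scalerA -(Pa V h _ _ _ ex).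
  rewrite -(Pb V h _ _ _ ex) scaler_sumr -big_split; apply: eq_bigr => i _ /=.
  by rewrite (con_linearr conP) gmul_linearr.
- case=> // k U V h a Pa W l n e x ex.
  by rewrite (res_comp _ _ (subset_trans l h)); apply: Pa.
- case=> // k U I V h a cov Pa W l n e x ex.
  apply: (res_separated cov l) => i Z hV hW.
  have hU := subset_trans hV (h i).
  have := Pa i Z hV _ _ _ (is_frame_res hW ex).
  rewrite (res_comp _ _ hU) resZ (res_comp _ _ hU) res_sum.
  have -> : Ores hW k.+1%:R = k.+1%:R.
    by apply: O_ext => u; elim: k.+1 => // m IH; rewrite !mulrS !OaddE -IH.
  move=> <-; apply: eq_bigr => p _.
  by rewrite gmul_res shom_res (con_res conP) (res_comp _ _ hU).
- by [].
- case=> [|k] U s a Pa V h n e x ex.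
    rewrite gmul_res shom_res gmulE0 scale1r {2}(dual_frame_expand (res h s) ex).
    rewrite shom_sum scaler_sumr; apply: eq_bigr => i _.
    by rewrite conZr (con_gen conP) scalerA gmulE0 gcoefK shomZ scalerA.
  rewrite gmul_res shom_res; set a' := res h a; set s' := res h s.
  transitivity (\sum_i (gmul (add1n k.+1) (j V (pairing s' (e i) *: x i)) a' +
      gmul (add1n k.+1) (j V s') (gmul (add1n k) (j V (x i)) (con (e i) a')))).
    apply: eq_bigr => i _; rewrite con_genM.
    rewrite gmulDr gmulNr gmulZr shomZ gmulZl; congr (_ + _).
    have e2 : (2 + k)%N = k.+2 by [].
    rewrite -!(gmulA (erefl 2) (add1n k) e2) (anticommutative_gen A_ext).
    by rewrite gmulNl opprK.
  rewrite big_split /= -gmul_suml -gmul_sumr -shom_sum -(dual_frame_expand s' ex).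
  by rewrite (Pa V h _ _ _ ex) gmulZr [k.+2%:R]mulrS scalerDl scale1r.
Qed.

Hypothesis E_free : locally_free_finite E.
Hypothesis K0 : [pchar K] =i pred0.

Lemma con_eq0 k U (a : A k.+1 U) :
  (forall V (h : V `<=` U) D, con D (res h a) = 0) -> a = 0.
Proof.
move=> a0; apply: (framed_separated E_free) => V h [n [e [x ex]]].
have [c c1] := OX_natr_unit V k K0; rewrite res0 -[LHS]scale1r -c1 -scalerA.
by rewrite -(sum_gen_con (res h a) ex) big1 ?scaler0 // => i _; rewrite a0 gmul0r.
Qed.

Lemma con_inj k U (a b : A k.+1 U) :
  (forall V (h : V `<=` U) D, con D (res h a) = con D (res h b)) -> a = b.
Proof.
move=> ab; apply/eqP; rewrite -subr_eq0; apply/eqP/con_eq0 => V h D.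
by rewrite resD resN conBr ab subrr.
Qed.

Lemma con2_inj U (a b : A 2 U) :
  (forall V (h : V `<=` U) D D', con D' (con D (res h a)) = con D' (con D (res h b))) ->
  a = b.
Proof.
move=> ab; apply: con_inj => V h D; apply: con_inj => W k D'.
by rewrite !(con_res conP) !(res_comp _ _ (subset_trans k h)) ab.
Qed.

(** The functional D |-> i_D a is a section of E^* whose image under j has the same contractions as
    a. *)
Lemma gen_of_degree1 U (a : A 1%N U) : exists s, a = j U s.
Proof.
have s_lin V (h : V `<=` U) f (D D' : E V) : gcoef (con (f *: D + D') (res h a)) =
    f * gcoef (con D (res h a)) + gcoef (con D' (res h a)).
  by rewrite (con_linearl conP) gcoef_linear.
have s_res V W (h : V `<=` U) (k : W `<=` V) (l : W `<=` U) (D : E V) :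
    Ores k (gcoef (con D (res h a))) = gcoef (con (res k D) (res l a)).
  by rewrite gcoef_res (con_res conP) (res_comp _ _ l).
pose s : dual E U := @HomOver _ _ X E O_sheaf U
  (fun V h D => gcoef (con D (res h a))) s_lin s_res.
exists s; apply: con_inj => V h D.
by rewrite shom_res (con_gen conP) -hom_funE /= -gcoefE.
Qed.

(** This fixes the order of arguments: i_D' i_D w is w(D, D') in the determinant convention of
    [is_evaluation]. *)
Lemma con2_gen U s t D D' :
  con D' (con D (gmul (erefl 2) (j U s) (j U t))) =
    (pairing s D * pairing t D' - pairing s D' * pairing t D) *: gone A U.
Proof.
rewrite (gmul_irr _ (add1n 1)) con_genM conBr conZr !(con_gen conP) gmulZr conZr.
rewrite (gmul_irr (add1n 0) (addn0 1)) gmulr1 (con_gen conP) !scalerA.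
by rewrite -scalerBl [X in _ - X]mulrC.
Qed.

(** Alternating bilinear forms on E are sections of A^2: there is a formula over a frame, and
    [con2_inj] provides the uniqueness needed to glue. *)
Lemma two_form_exists U (b : forall V, V `<=` U -> E V -> E V -> OX V) :
  (forall V h f D D' D'', b V h (f *: D + D') D'' = f * b V h D D'' + b V h D' D'') ->
  (forall V h D D', b V h D D' = - b V h D' D) ->
  (forall V W h (k : W `<=` V) l D D', Ores k (b V h D D') = b W l (res k D) (res k D')) ->
  exists w : A 2 U, forall V h D D',
    con D' (con D (res h w)) = b V h D D' *: gone A V.
Proof.
move=> b_lin b_anti b_res.
have b_0 V h D : b V h 0 D = 0.
  apply: (addrI (b V h 0 D)); have := b_lin V h 1 0 0 D.
  by rewrite scale1r mul1r !addr0.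
have b_suml V h n (f : 'I_n -> OX V) e D :
    b V h (\sum_i f i *: e i) D = \sum_i f i * b V h (e i) D.
  by elim/big_rec2: _ => [|i x y _ <-]; rewrite ?b_0 ?b_lin.
have b_sumr V h n (f : 'I_n -> OX V) e D :
    b V h D (\sum_i f i *: e i) = \sum_i f i * b V h D (e i).
  by rewrite b_anti b_suml -sumrN; apply: eq_bigr => i _; rewrite b_anti mulrN opprK.
pose R V (h : V `<=` U) (w : A 2 V) := forall W (k : W `<=` V) l D D',
  con D' (con D (res k w)) = b W l D D' *: gone A W.
have [w wP] : exists w, R U (@subset_refl _ U) w; last first.
  by exists w => V h D D'; apply: wP.
apply: (framed_glue E_free)
  => [V h s t sP tP|V W h k l s sP Z m l' D D'|V h s sP W k l D D'|V h].
- apply: con2_inj => W k D D'.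
  by rewrite (sP _ _ (subset_trans k h)) (tP _ _ (subset_trans k h)).
- by rewrite (res_comp _ _ (subset_trans m k)) (sP _ _ l').
- rewrite [LHS]gcoefE; congr (_ *: _).
  apply: (framed_separated E_free (G := O_sheaf)) => Z m fZ /=.
  have hZ := subset_trans m k; have lZ := subset_trans m l.
  rewrite gcoef_res !(con_res conP) (res_comp _ _ hZ) (b_res _ _ _ _ lZ).
  have := sP Z hZ lZ fZ Z (@subset_refl _ _) lZ (res m D) (res m D').
  by rewrite res_id => ->; rewrite gcoefK.
(* With c = 1/2, the form is c times the sum of b(e_i, e_k) x_i x_k: its double contractions are c
   (b(D, D') - b(D', D)) = b(D, D'). *)
- move=> [n [e [x ex]]]; have [c c2] := OX_natr_unit V 1 K0.
  exists (c *: \sum_i \sum_k b V h (e i) (e k) *: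
    gmul (erefl 2) (j V (x i)) (j V (x k))) => W k l D D'.
  have ex' := is_frame_res k ex.
  have bE D1 D2 : b W l D1 D2 = \sum_i \sum_p b W l (res k (e i)) (res k (e p)) *
      (pairing (res k (x i)) D1 * pairing (res k (x p)) D2).
    rewrite {1}(frame_expand D1 ex') b_suml; apply: eq_bigr => i _.
    rewrite {1}(frame_expand D2 ex') b_sumr mulr_sumr; apply: eq_bigr => p _.
    by rewrite mulrA mulrC.
  transitivity ((Ores k c * (b W l D D' - b W l D' D)) *: gone A W); last first.
    rewrite [b W l D' D]b_anti opprK; congr (_ *: _).
    have c2' : Ores k c * 2%:R = 1.
      have <- : Ores k 2%:R = 2%:R by apply: O_ext.
      by rewrite -OresM c2 Ores1.
    by rewrite -mulr2n -[RHS]mul1r -c2' -mulrA mulr_natl.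
  rewrite resZ !conZr -scalerA; congr (_ *: _).
  rewrite 2!bE -sumrB res_sum !con_sumr scaler_suml; apply: eq_bigr => i _.
  rewrite -sumrB res_sum !con_sumr scaler_suml; apply: eq_bigr => p _.
  rewrite resZ !conZr gmul_res !shom_res con2_gen scalerA (b_res _ _ _ _ l).
  by rewrite -mulrBr.
Qed.

End ContractionTheory.

(** * Cartan calculus *)

Section OddDerivationTheory.
Context {K : fieldType} {KO : set (set K)} {X : ringed_space KO}.
Implicit Types (U V W : opens X).
Variable A : galgebra (X := X).
Variable d : forall k U, A k U -> A k.+1 U.
Hypothesis dP : is_odd_derivation (@d).

(** This is [oder_linear] at f = 1, once the same identity has given d 0 = 0 and d 1 = 0. *)
Lemma oderD k U (a b : A k U) : d (a + b) = d a + d b.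
Proof.
have dL := oder_linear dP.
have dL0 l V : d (0 : A l V) = 0.
  have := dL l V 1 0 0; rewrite gmul0r !scale1r addr0 add0r => e.
  by apply: (addrI (d 0)); rewrite addr0 -e.
have d1 : d (gone A U) = 0.
  have := dL 0%N U 1 (gone A U) 0; rewrite !scale1r !addr0 dL0 addr0.
  rewrite (gmul_irr _ (addn0 1)) gmulr1 => e.
  by apply: (addrI (d (gone A U))); rewrite addr0 -e.
by have := dL k U 1 a b; rewrite !scale1r d1 gmul0l add0r.
Qed.

Lemma oder0 k U : d (0 : A k U) = 0.
Proof. by apply: (addrI (d 0)); rewrite -oderD !addr0. Qed.

Lemma oderZ k U f (a : A k U) :
  d (f *: a) = gmul (add1n k) (d (f *: gone A U)) a + f *: d a.
Proof. by have := oder_linear dP f a 0; rewrite oder0 !addr0. Qed.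

Lemma oderN k U (a : A k U) : d (- a) = - d a.
Proof. by apply: (addrI (d a)); rewrite -oderD !subrr oder0. Qed.

Lemma oderB k U (a b : A k U) : d (a - b) = d a - d b.
Proof. by rewrite oderD oderN. Qed.

Lemma oderM1 k U (w : A 1%N U) (a : A k U) :
  d (gmul (add1n k) w a) =
    gmul (erefl : (2 + k)%N = k.+2) (d w) a - gmul (add1n k.+1) w (d a).
Proof. by rewrite (oder_leibniz dP _ erefl (add1n k.+1)) expr1 scaleN1r. Qed.
End OddDerivationTheory.

Section Cartan.
Context {K : fieldType} {KO : set (set K)} {X : ringed_space KO}.
Implicit Types (U V W : opens X).
Variables (E : module_sheaf X) (A : galgebra (X := X)).
Variable j : sheaf_hom (dual E) (A 1%N).
Hypothesis A_ext : is_exterior_algebra j.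
Variable con : forall k U, E U -> A k.+1 U -> A k U.
Hypothesis conP : is_contraction j (@con).
Variable d : forall k U, A k U -> A k.+1 U.
Hypothesis dP : is_odd_derivation (@d).

(** The Lie derivative L_D = [d, i_D]; in degree 0 the term with i_D applied first vanishes. *)
Definition lie k : forall U, E U -> A k U -> A k U :=
  match k return forall U, E U -> A k U -> A k U with
  | 0 => fun U D a => con D (d a)
  | k'.+1 => fun U D a => con D (d a) + d (con D a)
  end.

(** The anchor read off from d, that is f |-> (df)(D). *)
Definition rho U (D : E U) (f : OX U) : OX U := gcoef (con D (d (f *: gone A U))).

Lemma con_d_fun U (D : E U) f : con D (d (f *: gone A U)) = rho D f *: gone A U.
Proof. exact: gcoefE. Qed.

Lemma lie_fun U (D : E U) f : lie D (f *: gone A U) = rho D f *: gone A U.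
Proof. exact: gcoefE. Qed.

Lemma lieD k U (D : E U) (a b : A k U) : lie D (a + b) = lie D a + lie D b.
Proof.
case: k a b => [|k] a b /=; rewrite !(oderD dP) !(conDr conP) //.
by rewrite (oderD dP) addrACA.
Qed.

Lemma lieN k U (D : E U) (a : A k U) : lie D (- a) = - lie D a.
Proof.
have lie0 : lie D (0 : A k U) = 0.
  by apply: (addrI (lie D 0)); rewrite -lieD !addr0.
by apply: (addrI (lie D a)); rewrite -lieD !subrr lie0.
Qed.

Lemma lieB k U (D : E U) (a b : A k U) : lie D (a - b) = lie D a - lie D b.
Proof. by rewrite lieD lieN. Qed.

Lemma lieZ k U (D : E U) f (a : A k U) : lie D (f *: a) = rho D f *: a + f *: lie D a.
Proof.
case: k a => [|k] a /=.
  rewrite (oderZ dP) (conDr conP) (conM10 conP) (conZr conP) con_d_fun.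
  by congr (_ + _); rewrite {2}(gcoefE a) !scalerA mulrC.
rewrite (oderZ dP f a) (conDr conP) (conM1 conP) !(conZr conP) (oderZ dP f (con D a)).
rewrite con_d_fun gmul0E gcoefK scalerDr [LHS](AC (3*2) (1*(3*5)*(2*4)))/=.
by rewrite addNr addr0.
Qed.

Lemma lie_res k U V (h : V `<=` U) (D : E U) (a : A k U) :
  res h (lie D a) = lie (res h D) (res h a).
Proof.
case: k a => [|k] a /=.
  by rewrite (con_res conP) (oder_res dP).
by rewrite resD (con_res conP) !(oder_res dP) (con_res conP).
Qed.

Lemma lieM1 k U (D : E U) (w : A 1%N U) (a : A k U) :
  lie D (gmul (add1n k) w a) =
    gmul (add1n k) (lie D w) a + gmul (add1n k) w (lie D a).
Proof.
case: k a => [|k] a.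
  by rewrite !gmulE0 lieZ [RHS]addrC /rho -gcoefE.
have [e2 e3] : (2 + k = k.+2)%N /\ (1 + k.+1 = k.+2)%N by [].
rewrite /= (oderM1 dP) (conBr conP) (conM conP _ e3 e2) !(conM1 conP).
rewrite !gmul0E (oderB dP) (oderZ dP) -gcoefE (oderM1 dP) gmulDl gmulDr.
rewrite sqrrN expr1n scale1r (gmul_irr e3 (add1n k.+1)) (gmul_irr e2 erefl) !opprB.
(* The mixed terms (dw)(i_D a) and (i_D w)(da) occur twice with opposite signs. *)
rewrite [LHS](AC ((2*2)*(2*2)) ((1*5)*(3*7)*((2*8)*(4*6))))/=.
by rewrite subrr addNr !addr0.
Qed.

(** The bracket is tied to d by [br_gen] on generators, so the calculus applies both when d is built
    from a bracket and when the bracket is built from d. *)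
Variable br : forall U, E U -> E U -> E U.
Hypothesis br_res : forall U V (h : V `<=` U) (D D' : E U),
  res h (br D D') = br (res h D) (res h D').
Hypothesis br_gen : forall U (D D' : E U) s,
  con D' (lie D (j U s)) + con (br D D') (j U s) = lie D (con D' (j U s)).

(** Both [L_D, i_D'] and i_[D, D'] are derivations of degree -1 of A, so their agreement on
    generators propagates to products. *)
Lemma cartan k U (D D' : E U) (a : A k.+1 U) :
  con D' (lie D a) = lie D (con D' a) - con (br D D') a.
Proof.
pose P k : forall U, A k U -> Prop := match k return forall U, A k U -> Prop with
  | 0 => fun U a => True
  | k'.+1 => fun U a => forall V (h : V `<=` U) (D D' : E V),
      con D' (lie D (res h a)) = lie D (con D' (res h a)) - con (br D D') (res h a)
  end.
suff Pa k' U' a' : P k' U' a'.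
  by have := Pa k.+1 U a U (@subset_refl _ U) D D'; rewrite res_id.
move: k' U' a' => {k U D D' a}.
have P_gen U (D D' : E U) s :
    con D' (lie D (j U s)) = lie D (con D' (j U s)) - con (br D D') (j U s).
  by rewrite -br_gen addrK.
apply: (exterior_ind_gen A_ext).
- case=> // k U f a b Pa Pb V h D D'.
  rewrite res_linear lieD lieZ !(con_linearr conP) lieD lieZ 2!(conDr conP) !(conZr conP).
  rewrite (Pa V h) (Pb V h) scalerBr opprD.
  by rewrite [LHS](AC ((1*2)*2) ((1*2*4)*(3*5)))/=.
- case=> // k U V h a Pa W l D D'.
  by rewrite (res_comp _ _ (subset_trans l h)); apply: Pa.
- case=> // k U I V h a cov Pa W l D D'.
  apply: (res_separated cov l) => i Z hV hW.
  have hU := subset_trans hV (h i).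
  have := Pa i Z hV (res hW D) (res hW D').
  rewrite resD resN !(con_res conP) !lie_res !(con_res conP) br_res.
  by rewrite !(res_comp _ _ hU).
- by [].
- case=> [|k] U s a Pa V h D D'.
    rewrite gmul_res shom_res gmulE0 lieZ !(conDr conP) !(conZr conP) lieZ P_gen.
    by rewrite scalerBr addrA.
  rewrite gmul_res shom_res lieM1 (conDr conP) !(conM1 conP) lieB.
  rewrite lieM1 !gmul0E lieZ (Pa V h) P_gen gcoefB /rho -gcoefE scalerBl.
  rewrite gmulDr gmulNr !opprB opprD.
  by rewrite [LHS](AC (3*(1*2)) (((1*4)*(3*6))*(5*2)))/=.
Qed.

Hypothesis dd_fun : forall U (a : A 0%N U), d (d a) = 0.

Lemma con_dd_fun U (D D' : E U) (a : A 0%N U) :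
  con D' (con D (d (d a))) = lie D (lie D' a) - lie D' (lie D a) - lie (br D D') a.
Proof.
have e : con D (d (d a)) = lie D (d a) - d (lie D a) by rewrite /= addrK.
by rewrite e (conBr conP) cartan addrAC.
Qed.

(** On functions the Lie derivative is the anchor, so this expresses that the anchor sends brackets
    to commutators. *)
Lemma lie_bracket_fun U (D D' : E U) (a : A 0%N U) :
  lie (br D D') a = lie D (lie D' a) - lie D' (lie D a).
Proof.
apply/esym/eqP; rewrite -subr_eq0 -con_dd_fun dd_fun.
by rewrite !(con0r conP).
Qed.

Lemma con_dd U (D D' : E U) (w : A 1%N U) :
  con D' (con D (d (d w))) = lie D (lie D' w) - lie D' (lie D w) - lie (br D D') w.
Proof.
have e1 : con D (d (d w)) = lie D (d w) - d (lie D w).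
  by rewrite /= (oderD dP) dd_fun addr0 addrK.
have e2 D1 (a : A 1%N U) : con D1 (d a) = lie D1 a - d (con D1 a).
  by rewrite /= addrK.
have e3 (a : A 0%N U) : lie D (d a) = d (lie D a).
  by rewrite /= dd_fun (con0r conP) add0r.
rewrite e1 (conBr conP) cartan !e2 lieB e3 cartan (oderB dP) !opprB.
rewrite [LHS](AC ((2*2)*(2*1)) ((1*7*4)*((2*5)*(3*6))))/=.
by rewrite addNr subrr !addr0.
Qed.

(* Modulo the anchor condition, d^2 = 0 on A^1 is the Jacobi identity. *)
Lemma con3_dd U (D D' D'' : E U) (w : A 1%N U) :
  con D'' (con D' (con D (d (d w)))) =
    con (br D' (br D D'') - br D (br D' D'') + br (br D D') D'') w.
Proof.
rewrite con_dd !(conBr conP) !cartan !lieB lie_bracket_fun (conDl conP) (conBl conP).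
rewrite !opprB [LHS](AC (((2*2)*(2*2))*(1*2))
  ((3*6*9)*((1*11)*(2*5)*((4*7)*(8*10)))))/=.
by rewrite subrr !addNr !addr0.
Qed.

End Cartan.

(** * The Chevalley-Eilenberg algebra in degrees at most 2 *)

Lemma det_mx22 (R : comPzRingType) (M : 'M[R]_2) :
  \det M = M ord0 ord0 * M ord_max ord_max - M ord0 ord_max * M ord_max ord0.
Proof.
have e1 : lift ord0 ord0 = ord_max :> 'I_2 by apply: val_inj.
have e2 : lift ord_max ord0 = ord0 :> 'I_2 by apply: val_inj.
rewrite (expand_det_row _ ord0) !big_ord_recl big_ord0 addr0 /cofactor !det_mx11 !mxE.
by rewrite !e1 e2 /= addn0 expr0 expr1 mul1r mulN1r mulrN.
Qed.

Section DegreeTwo.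
Context {K : fieldType} {KO : set (set K)} {X : ringed_space KO}.
Implicit Types (U V W : opens X).
Variables (E : module_sheaf X) (A : galgebra (X := X)).
Variable j : sheaf_hom (dual E) (A 1%N).
Hypothesis A_ext : is_exterior_algebra j.
Variable con : forall k U, E U -> A k.+1 U -> A k U.
Hypothesis conP : is_contraction j (@con).
Hypothesis E_free : locally_free_finite E.
Hypothesis K0 : [pchar K] =i pred0.

(** Induction on generators with a property that is trivial outside degree 2; as every 1-form is a
    generator, products of two generators suffice. *)
Lemma exterior_ind2 (P : forall U, A 2 U -> Prop) :
  (forall U f (a b : A 2 U), P U a -> P U b -> P U (f *: a + b)) ->
  (forall U V (h : V `<=` U) (a : A 2 U), P U a -> P V (res h a)) ->
  (forall U I (V : I -> opens X) (h : forall i, V i `<=` U) (a : A 2 U),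
     covers U V -> (forall i, P (V i) (res (h i) a)) -> P U a) ->
  (forall U s t, P U (gmul (erefl 2) (j U s) (j U t))) ->
  forall U (a : A 2 U), P U a.
Proof.
move=> P_lin P_res P_loc P_gen U a.
pose Q k : forall U, A k U -> Prop :=
  match k return forall U, A k U -> Prop with 2 => P | _ => fun U a => True end.
suff Qa k' U' a' : Q k' U' a' by exact: (Qa 2 U a).
move: k' U' a' => {U a}; apply: (exterior_ind_gen A_ext).
- by case=> [|[|[|k]]] //; apply: P_lin.
- by case=> [|[|[|k]]] //; apply: P_res.
- by case=> [|[|[|k]]] //; apply: P_loc.
- by [].
- case=> [|[|[|k]]] // U s a _ /=.
  have [t ->] := gen_of_degree1 A_ext conP E_free K0 a.
  by rewrite (gmul_irr (add1n 1) erefl).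
Qed.

Lemma con_con U D (a : A 2 U) : con D (con D a) = 0.
Proof.
suff Pa U' (b : A 2 U') V (h : V `<=` U') D' : con D' (con D' (res h b)) = 0.
  by rewrite -(Pa U a U (@subset_refl _ U) D) res_id.
move: U' b V h D' => {U D a}.
apply: (exterior_ind2 (P := fun U b => forall V (h : V `<=` U) D',
  con D' (con D' (res h b)) = 0))
  => [U f a b Pa Pb V h D|U V h a Pa W i D|U I V h a cov Pa W l D|U s t V h D].
- by rewrite res_linear !(con_linearr conP) Pa Pb scaler0 addr0.
- by rewrite (res_comp _ _ (subset_trans i h)) Pa.
- apply: (res_separated cov l) => i Z hV hW; have hU := subset_trans hV (h i).
  have := Pa i Z hV (res hW D).
  by rewrite !(con_res conP) res0 !(res_comp _ _ hU).
- by rewrite gmul_res !shom_res (con2_gen conP) mulrC subrr scale0r.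
Qed.

Lemma con_anti U D D' (a : A 2 U) : con D' (con D a) = - con D (con D' a).
Proof.
have := con_con (D + D') a.
rewrite !(conDl conP) !(conDr conP) !con_con add0r addr0 addrC.
by move/eqP; rewrite addr_eq0 => /eqP.
Qed.
End DegreeTwo.

Section ContractionMorphism.
Context {K : fieldType} {KO : set (set K)} {X : ringed_space KO}.
Implicit Types (U V W : opens X).
Variables (E L : module_sheaf X) (A B : galgebra (X := X)).
Variables (jA : sheaf_hom (dual E) (A 1%N)) (jB : sheaf_hom (dual L) (B 1%N)).
Hypothesis B_ext : is_exterior_algebra jB.
Variable conA : forall k U, E U -> A k.+1 U -> A k U.
Hypothesis conAP : is_contraction jA (@conA).
Variable conB : forall k U, L U -> B k.+1 U -> B k U.
Hypothesis conBP : is_contraction jB (@conB).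
Variables (psi : galgebra_hom B A) (phi : forall U, E U -> L U).
Hypothesis phi_res : forall U V (h : V `<=` U) D, res h (phi D) = phi (res h D).
Hypothesis psi_gen : forall U D a,
  conA D (psi 1%N U (jB U a)) = pairing a (phi D) *: gone A U.

(** Both sides are derivations along psi in w, and on generators they agree because [psi_gen] makes
    phi the transpose of psi in degree 1. *)
Lemma con_morphism k U D (w : B k.+1 U) :
  conA D (psi k.+1 U w) = psi k U (conB (phi D) w).
Proof.
pose P k : forall U, B k U -> Prop := match k return forall U, B k U -> Prop with
  | 0 => fun U w => True
  | k'.+1 => fun U w => forall V (h : V `<=` U) D,
      conA D (psi k'.+1 V (res h w)) = psi k' V (conB (phi D) (res h w))
  end.
suff Pw k' U' w' : P k' U' w'.
  by have := Pw k.+1 U w U (@subset_refl _ U) D; rewrite res_id.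
move: k' U' w' => {k U D w}.
have P_gen U D a : conA D (psi 1%N U (jB U a)) = psi 0%N U (conB (phi D) (jB U a)).
  by rewrite psi_gen (con_gen conBP) shomZ ghom1.
apply: (exterior_ind_gen B_ext).
- case=> // k U f a b Pa Pb V h D.
  rewrite res_linear shom_linear (con_linearr conAP) (con_linearr conBP) shom_linear.
  by rewrite (Pa V h) (Pb V h).
- case=> // k U V h a Pa W l D.
  by rewrite (res_comp _ _ (subset_trans l h)); apply: Pa.
- case=> // k U I V h a cov Pa W l D.
  apply: (res_separated cov l) => i Z hV hW.
  have hU := subset_trans hV (h i); have := Pa i Z hV (res hW D).
  by rewrite (con_res conAP) !shom_res (con_res conBP) phi_res !(res_comp _ _ hU).
- by [].
- case=> [|k] U s a Pa V h D; rewrite gmul_res shom_res ghomM.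
    rewrite (conM10 conAP) (conM10 conBP) shomZ P_gen; congr (_ *: _).
    by rewrite {1}(gcoefE (res h a)) shomZ ghom1 gcoefK.
  rewrite (conM1 conAP) (conM1 conBP) shomB !ghomM P_gen.
  by rewrite (Pa V h).
Qed.
End ContractionMorphism.

Section ChevalleyEilenberg.
Context {K : fieldType} {KO : set (set K)} {X : ringed_space KO}.
Implicit Types (U V W : opens X).
Hypothesis K0 : [pchar K] =i pred0.
Variables (L : lie_algebroid (X := X)) (Omega : CE_algebra L).
Hypothesis L_free : locally_free_finite L.
Local Notation jO := (ce_gen Omega).
Variable con : forall k U, L U -> Omega k.+1 U -> Omega k U.
Hypothesis conP : is_contraction jO (@con).

Let Omega_ext := ce_exterior Omega.

Lemma ce_eval_fun U f D : ce_eval (f *: gone Omega U) D = f.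
Proof.
have [evL _ ev_prod] := ce_evalP Omega.
have ev0 : ce_eval (0 : Omega 0%N U) D = 0.
  apply: (addrI (ce_eval (0 : Omega 0%N U) D)).
  by have := evL 0%N U 1 0 0 D; rewrite scale1r mul1r !addr0.
have := evL 0%N U f (gone Omega U) 0 D; rewrite ev0 !addr0 => ->.
(* The empty product is the unit and the empty determinant is 1. *)
have /= -> := ev_prod 0%N U (fun=> 0) D.
by rewrite det_mx00 mulr1.
Qed.

Lemma ce_eval_gen U a D : ce_eval (jO U a) D = pairing a (D ord0).
Proof.
have [_ _ ev_prod] := ce_evalP Omega.
have := ev_prod 1%N U (fun=> a) D; rewrite det_mx11 mxE => <- /=.
by rewrite (gmul_irr (add1n 0) (addn0 1)) gmulr1.
Qed.

Lemma ce_eval_con1 U (w : Omega 1%N U) D : con (D ord0) w = ce_eval w D *: gone Omega U.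
Proof.
have [a ->] := gen_of_degree1 Omega_ext conP L_free K0 w.
by rewrite (con_gen conP) ce_eval_gen.
Qed.

(** Iterated contraction and evaluation are given by the same 2 x 2 determinant on products of two
    generators; hence [ce_diffE] can be read through contractions. *)
Lemma ce_eval_con2 U (w : Omega 2 U) D :
  con (D ord_max) (con (D ord0) w) = ce_eval w D *: gone Omega U.
Proof.
have [evL ev_res ev_prod] := ce_evalP Omega.
suff Pw U' (b : Omega 2 U') V (h : V `<=` U') (D' : 'I_2 -> L V) :
    con (D' ord_max) (con (D' ord0) (res h b)) = ce_eval (res h b) D' *: gone Omega V.
  by rewrite -(res_id (@subset_refl _ U) w) Pw.
move: U' b V h D' => {U D w}.
apply: (exterior_ind2 Omega_ext conP L_free K0
  (P := fun U b => forall V (h : V `<=` U) D',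
  con (D' ord_max) (con (D' ord0) (res h b)) = ce_eval (res h b) D' *: gone Omega V))
  => [U f a b Pa Pb V h D|U V h a Pa W i D|U I V h a cov Pa W l D|U s t V h D].
- by rewrite res_linear !(con_linearr conP) Pa Pb evL scalerDl scalerA.
- by rewrite (res_comp _ _ (subset_trans i h)) Pa.
- apply: (res_separated cov l) => i Z hV hW; have hU := subset_trans hV (h i).
  have := Pa i Z hV (fun p => res hW (D p)).
  rewrite !(con_res conP) resZ ev_res gone_res !(res_comp _ _ hU) => ->.
  by [].
- rewrite gmul_res !shom_res (con2_gen conP); congr (_ *: _).
  pose a (p : 'I_2) := if p == ord0 then res h s else res h t.
  have := ev_prod 2 V a D; rewrite det_mx22 !mxE /= => <-.
  congr (ce_eval _ D); rewrite (gmul_irr (add1n 0) (addn0 1)) gmulr1.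
  exact: gmul_irr.
Qed.

Lemma ce_d_fun U f : dga_diff Omega 0%N U (f *: gone Omega U) =
  jO U (dual_map (anchor L) U (d_X f)).
Proof.
apply: (con_inj Omega_ext conP L_free K0) => V h D.
rewrite dfun_res shom_res (con_gen conP) resZ gone_res.
rewrite (ce_eval_con1 _ (fun=> D)) ce_diffE /CE_formula; congr (_ *: _).
rewrite !big_ord_recl !big_ord0 !addr0 big_mkcond /= big_ord_recl big_ord0 /=.
rewrite !addr0 expr0 mul1r ce_eval_fun; congr (der_app _ (Ores _ f)).
exact: Prop_irrelevance.
Qed.

Lemma ce_d_gen U a D D' : con D' (con D (dga_diff Omega 1%N U (jO U a))) =
  (der_app (anchor L U D) (pairing a D') - der_app (anchor L U D') (pairing a D)
   - pairing a (bracket L D D')) *: gone Omega U.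
Proof.
pose DD (p : 'I_2) := if p == ord0 then D else D'.
rewrite (ce_eval_con2 _ DD) ce_diffE /CE_formula; congr (_ *: _).
rewrite !big_ord_recl !big_ord0 /= !addr0 !big_mkcond /= !big_ord_recl !big_ord0 /=.
rewrite !ce_eval_gen /DD /=.
rewrite big_mkcond !big_ord_recl big_ord0 /=.
by rewrite expr0 expr1 mul1r !mulN1r !addr0 add0r.
Qed.
End ChevalleyEilenberg.

(** * From a Lie algebroid to a differential *)

Section AlgebroidToDifferential.
Context {K : fieldType} {KO : set (set K)} {X : ringed_space KO}.
Implicit Types (U V W : opens X).
Hypothesis K0 : [pchar K] =i pred0.

Lemma Ocst1 U : Ocst U (1 : K) = 1.
Proof. exact: O_ext. Qed.

Lemma differential_odd (A : galgebra (X := X)) (d : differential A) :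
  is_odd_derivation d.
Proof.
have dD k U (a b : A k U) : d k U (a + b) = d k U a + d k U b.
  by have := dfun_linear d 1 a b; rewrite Ocst1 !scale1r.
split=> [k U f a b|k U V h a|k l n h h1 h2 U a b].
- rewrite dD; congr (_ + _); rewrite -{1}[a](gmul1 (add0n k)) -gmulZl.
  by rewrite (dfunM d _ (add1n k) (add0n k.+1)) expr0 scale1r gmulZl gmul1.
- exact: dfun_res.
- exact: dfunM.
Qed.

(** * Anchor, bracket and the differential of a 1-form in a Lie algebroid *)

Section LieAlgebroidTheory.
Variables (E : module_sheaf X) (S : lie_algebroid_on E).
Local Notation "D '|>' f" := (der_app (anchor S _ D) f) (at level 38).

Lemma act_linearl U f (D D' : E U) g : (f *: D + D') |> g = f * (D |> g) + D' |> g.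
Proof. by rewrite shom_linear /der_app /= Ores_id. Qed.

Lemma actD U (D : E U) g g' : D |> (g + g') = D |> g + D |> g'.
Proof. exact: der_additive. Qed.

Lemma actM U (D : E U) g g' : D |> (g * g') = g * (D |> g') + g' * (D |> g).
Proof. exact: der_leibniz. Qed.

Lemma act_cst U (D : E U) c : D |> Ocst U c = 0.
Proof.
have D1 : D |> 1 = 0.
  by apply: (addrI (D |> 1)); rewrite addr0 -[in RHS](mulr1 1) actM !mul1r.
by rewrite -[Ocst U c]mulr1 /der_app derZ -/(der_app _ _) D1 mulr0.
Qed.

Lemma act_res U V (h : V `<=` U) (D : E U) g : Ores h (D |> g) = res h D |> Ores h g.
Proof.
rewrite -shom_res /der_app /= (der_res _ _ _ h).
by congr (der_fun _ _ _); apply: Prop_irrelevance.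
Qed.

Lemma bracketD U (D D' D'' : E U) :
  bracket S (D + D') D'' = bracket S D D'' + bracket S D' D''.
Proof.
by have := bracket_linearl S 1 D D' D''; rewrite Ocst1 !scale1r.
Qed.

Lemma bracket_anti U (D D' : E U) : bracket S D D' = - bracket S D' D.
Proof.
have Dr D1 D2 : bracket S D1 (D2 + D1) = bracket S D1 D2.
  have := bracket_linearr S 1 D1 D2 D1.
  by rewrite Ocst1 !scale1r bracketxx addr0.
have := bracketxx S (D + D'); rewrite bracketD Dr [D + D']addrC Dr.
by move/eqP; rewrite addr_eq0 => /eqP.
Qed.

Lemma bracketNr U (D D' : E U) : bracket S D (- D') = - bracket S D D'.
Proof.
have bDr D1 D2 : bracket S D (D1 + D2) = bracket S D D1 + bracket S D D2.
  by rewrite 3![bracket S D _]bracket_anti bracketD opprD.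
have b0 : bracket S D 0 = 0 by apply: (addrI (bracket S D 0)); rewrite -bDr !addr0.
by apply: (addrI (bracket S D D')); rewrite -bDr !subrr b0.
Qed.

(** The Jacobi identity in the shape in which [con3_dd] produces it. *)
Lemma jacobi_leibniz U (D D' D'' : E U) :
  bracket S D' (bracket S D D'') - bracket S D (bracket S D' D'') +
  bracket S (bracket S D D') D'' = 0.
Proof.
rewrite [bracket S D D'']bracket_anti bracketNr [bracket S (bracket S D D') _]bracket_anti.
apply: oppr_inj; rewrite oppr0 -(jacobi S D D' D'') !opprD !opprK.
by congr (_ + _); rewrite addrC.
Qed.

Lemma anchor_bracket_act U (D D' : E U) f :
  bracket S D D' |> f = D |> (D' |> f) - D' |> (D |> f).
Proof. by rewrite anchor_bracket. Qed.

Lemma pairing_d_X U f V (h : V `<=` U) (D : E V) :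
  pairing (res h (dual_map (anchor S) U (d_X f))) D = D |> Ores h f.
Proof. by rewrite -hom_funE. Qed.

(** The Chevalley-Eilenberg differential of the 1-form s, as a function of two sections. *)
Definition d_form U (s : dual E U) (D D' : E U) :=
  D |> pairing s D' - D' |> pairing s D - pairing s (bracket S D D').

Lemma d_form_anti U s (D D' : E U) : d_form s D D' = - d_form s D' D.
Proof.
rewrite /d_form bracket_anti.
have -> : pairing s (- bracket S D' D) = - pairing s (bracket S D' D).
  by rewrite -scaleN1r pairingZr mulN1r.
by rewrite opprB opprK opprB addrC addrA.
Qed.

(** The derivative of f produced by D'' acting on f <s, D> cancels the one from the Leibniz rule of
    the bracket. *)
Lemma d_form_linearl U s f (D D' D'' : E U) :
  d_form s (f *: D + D') D'' = f * d_form s D D'' + d_form s D' D''.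
Proof.
rewrite /d_form act_linearl pairing_linearr actD actM.
rewrite bracketD pairingDr.
have -> : bracket S (f *: D) D'' = f *: bracket S D D'' - (D'' |> f) *: D.
  by rewrite bracket_anti bracket_leibniz [bracket S D'' D]bracket_anti opprD scalerN opprK.
have -> : pairing s (f *: bracket S D D'' - (D'' |> f) *: D) =
    f * pairing s (bracket S D D'') - (D'' |> f) * pairing s D.
  by rewrite pairing_linearr -scaleN1r pairingZr mulN1r pairingZr.
ring.
Qed.

Lemma d_form_res U V (h : V `<=` U) s (D D' : E U) :
  Ores h (d_form s D D') = d_form (res h s) (res h D) (res h D').
Proof.
have OresB (f g : OX U) : Ores h (f - g) = Ores h f - Ores h g by apply: O_ext.
by rewrite /d_form !OresB !act_res !pairing_res bracket_res.
Qed.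
End LieAlgebroidTheory.

Variables (L : lie_algebroid (X := X)) (E : module_sheaf X).
Hypotheses (L_free : locally_free_finite L) (E_free : locally_free_finite E).
Variables (Omega : CE_algebra L) (A : galgebra (X := X)).
Variable j : sheaf_hom (dual E) (A 1%N).
Hypothesis A_ext : is_exterior_algebra j.

Lemma ce_dga_of_algebroid :
  lie_algebroid_over L E -> inhabited (CE_dga_structure Omega A).
Proof.
case=> S phi.
have [con conP] := contraction_exists A_ext.
have [conO conOP] := contraction_exists (ce_exterior Omega).
have injA := con2_inj A_ext conP E_free K0.
(* The Chevalley-Eilenberg formula prescribes the double contractions of ds, hence ds itself. *)
have delta_ex U (s : dual E U) : exists w : A 2 U, forall V (h : V `<=` U) D D',
    con _ _ D' (con _ _ D (res h w)) = d_form S (res h s) D D' *: gone A V.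
  apply: (two_form_exists A_ext conP E_free K0) => [V h f D D' D''|V h D D'|V W h k l D D'].
  - exact: d_form_linearl.
  - exact: d_form_anti.
  - by rewrite d_form_res (res_comp _ _ l).
pose delta U s := projT1 (cid (delta_ex U s)).
have deltaE U s : forall V (h : V `<=` U) D D',
    con _ _ D' (con _ _ D (res h (delta U s))) = d_form S (res h s) D D' *: gone A V.
  exact: projT2 (cid (delta_ex U s)).
pose d0 U f := j U (dual_map (anchor S) U (d_X f)).
have d0E U f V (h : V `<=` U) D :
    con _ _ D (res h (d0 U f)) = der_app (anchor S V D) (Ores h f) *: gone A V.
  by rewrite shom_res (con_gen conP) pairing_d_X.
have [|||||d [dP d_fun d_gen]] :=
  odd_derivation_exists A_ext (d0 := d0) (delta := delta).
- move=> U f g; rewrite /d0 -shomD; congr (j U _); apply: dual_ext => V h D.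
  by rewrite pairing_d_X OresD actD -hom_funE.
- move=> U f g; rewrite /d0 -!shomZ -shomD; congr (j U _); apply: dual_ext => V h D.
  by rewrite pairing_d_X OresM actM -hom_funE.
- move=> U V h f; rewrite shom_res; congr (j V _); apply: dual_ext => W k D.
  rewrite (res_comp _ _ (subset_trans k h)) !pairing_d_X.
  by rewrite (Ores_comp _ _ (subset_trans k h)).
(* The terms of [d_form] that differentiate f add up to D(f) <s, D'> - D'(f) <s, D>, the value of
   (df) s. *)
- move=> U f s t; apply: injA => V h D D'.
  rewrite deltaE !resD !(conDr conP) !resZ !(conZr conP) !deltaE gmul_res.
  rewrite (conM1 conP) (conBr conP) gmul0E d0E gcoefK !(conZr conP) shom_res.
  rewrite !(con_gen conP) gmulE0 gcoefK (conZr conP) d0E.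
  rewrite !scalerA -scalerBl -!scalerDl; congr (_ *: _).
  by rewrite /d_form !pairing_linearl !actD !actM; ring.
- move=> U V h s; apply: injA => W k D D'.
  by rewrite (res_comp _ _ (subset_trans k h)) !deltaE (res_comp _ _ (subset_trans k h)).
(* d^2 f (D, D') is the failure of the anchor to respect [D, D'] applied to f. *)
have dd_fun U (a : A 0%N U) : d _ _ (d _ _ a) = 0.
  rewrite (gcoefE a) d_fun d_gen; apply: injA => V h D D'.
  rewrite deltaE !res0 !(con0r conP) /d_form !pairing_d_X anchor_bracket_act.
  by rewrite subrr scale0r.
have lie_gen U (D D' : E U) s : con _ _ D' (lie con d D (j U s)) =
    (der_app (anchor S U D) (pairing s D') - pairing s (bracket S D D')) *: gone A U.
  rewrite /= d_gen (con_gen conP) d_fun (conDr conP).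
  rewrite -[delta U s](res_id (@subset_refl _ U)) deltaE !res_id.
  rewrite -[d0 U _](res_id (@subset_refl _ U)) d0E Ores_id -scalerDl.
  by congr (_ *: _); rewrite /d_form addrAC addrNK.
have br_gen U (D D' : E U) s :
    con _ _ D' (lie con d D (j U s)) + con _ _ (bracket S D D') (j U s) =
    lie con d D (con _ _ D' (j U s)).
  rewrite lie_gen !(con_gen conP) -scalerDl subrK /= d_fun.
  by rewrite -[d0 U _](res_id (@subset_refl _ U)) d0E Ores_id.
have dd k U (a : A k U) : d _ _ (d _ _ a) = 0.
  move: k U a; apply: (exterior_ind_gen A_ext).
  - move=> k U f a b da db; rewrite !(oderD dP) db addr0 (oderZ dP) (oderD dP).
    rewrite (oderZ dP f (d k U a)) da scaler0 addr0 (oderM1 dP) dd_fun gmul0l.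
    by rewrite sub0r addNr.
  - by move=> k U V h a da; rewrite -!(oder_res dP) da res0.
  - move=> k U I V h a cov da; apply: (sheaf_separated (h := h) cov) => i.
    by rewrite !(oder_res dP) da res0.
  - by move=> U; apply: dd_fun.
  (* In d^2 (s a) the two terms (ds)(da) cancel, which reduces the claim to d^2 s = 0. *)
  - move=> k U s a da; have e2 : (3 + k)%N = k.+3 by [].
    have e3 : (2 + k.+1)%N = k.+3 by [].
    rewrite (oderM1 dP) (oderB dP) (oder_leibniz dP _ e2 e3) (oderM1 dP) da gmul0r subr0.
    rewrite sqrrN expr1n scale1r (gmul_irr e3 erefl) addrK.
    suff -> : d _ _ (d _ _ (j U s)) = 0 by rewrite gmul0l.
    (* A 3-form is determined by its triple contractions, and [con3_dd] expresses those of d^2 s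
       through the Jacobi identity. *)
    apply: (con_inj A_ext conP E_free K0) => V h D.
    apply: (con_inj A_ext conP E_free K0) => V' h' D'.
    apply: (con_inj A_ext conP E_free K0) => W h'' D''.
    rewrite !res0 !(con0r conP) !res0 !(con0r conP) res0 (con0r conP).
    rewrite !(con_res conP) !(oder_res dP).
    rewrite (con3_dd A_ext conP dP _ br_gen dd_fun); last first.
      by move=> *; apply: bracket_res.
    by rewrite jacobi_leibniz (con0l conP).
(* Derivations kill constants, whence the K-linearity of d. *)
have ocst_d U c : d0 U (Ocst U c) = 0.
  rewrite /d0 -(shom0 j); congr (j U _); apply: dual_ext => V h D.
  by rewrite pairing_d_X Ores_cst act_cst res0.
have d_lin k U (c : K) (a b : A k U) : d _ _ (Ocst U c *: a + b) =
    Ocst U c *: d _ _ a + d _ _ b.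
  by rewrite (oder_linear dP) d_fun ocst_d gmul0l add0r.
have jphi_lin U f (a b : dual L U) : j U (dual_map phi U (f *: a + b)) =
    f *: j U (dual_map phi U a) + j U (dual_map phi U b).
  by rewrite !shom_linear.
have jphi_res U V (h : V `<=` U) (a : dual L U) :
    res h (j U (dual_map phi U a)) = j V (dual_map phi V (res h a)).
  by rewrite !shom_res.
(* psi is the algebra map extending the transpose of phi on 1-forms. *)
have [|psi [psi_gen _]] := (ce_exterior Omega).2 A (@SheafHom _ _ X (dual L) (A 1%N)
  (fun U a => j U (dual_map phi U a)) jphi_lin jphi_res).
  by move=> h U s; apply: A_ext.1.
have psi_fun U f : d0 U f = psi 1%N U (ce_gen Omega U (dual_map (anchor L) U (d_X f))).
  rewrite psi_gen; congr (j U _); apply: dual_ext => V h D.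
  by rewrite pairing_d_X -hom_funE; have /= <- := la_hom_anchor phi D.
have con_psi k U D (w : Omega k.+1 U) :
    con _ _ D (psi k.+1 U w) = psi k U (conO _ _ (phi U D) w).
  apply: (con_morphism (ce_exterior Omega) conP conOP (psi := psi)) w => {k U D}.
    exact: shom_res.
  by move=> U D a; rewrite psi_gen (con_gen conP).
pose dA : differential A :=
  @Differential _ _ X A d d_lin (oder_res dP) dd (oder_leibniz dP).
pose B := DGA (exterior_commutative A_ext) dA.
have dO := differential_odd (dga_diff Omega).
(* Both psi d and d psi satisfy the Leibniz rule along psi, so functions and generators suffice. On
   generators, double contraction turns the claim into the compatibility of phi with brackets and
   anchors. *)
have psi_d k U (w : Omega k U) :
    psi k.+1 U (dga_diff Omega k U w) = dga_diff B k U (psi k U w).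
  rewrite /=; move: k U w; apply: (exterior_ind_gen (ce_exterior Omega)).
  - move=> k U f a b da db; rewrite (oder_linear dO) !shomD shomZ ghomM da db.
    rewrite (ce_d_fun K0 L_free conOP) -psi_fun -d_fun.
    by rewrite !shomZ (oder_linear dP).
  - by move=> k U V h a da; rewrite -shom_res -(oder_res dP) -da shom_res (oder_res dO).
  - move=> k U I V h a cov da; apply: (sheaf_separated (h := h) cov) => i.
    by rewrite shom_res (oder_res dO) da (oder_res dP) shom_res.
  - move=> U; rewrite ghom1 -[gone Omega U]scale1r (ce_d_fun K0 L_free conOP).
    by rewrite -psi_fun -d_fun scale1r.
  - move=> k U s a da; rewrite (oderM1 dO) ghomM (oderM1 dP) shomB !ghomM da.
    congr (gmul _ _ _ - _); rewrite psi_gen d_gen; apply: injA => V h D D'.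
    rewrite deltaE !shom_res (dfun_res (dga_diff Omega)) shom_res.
    rewrite !con_psi (ce_d_gen K0 L_free conOP).
    rewrite shomZ ghom1; congr (_ *: _).
    have /= phiS (D1 : E V) := la_hom_anchor phi D1.
    by have /= <- := la_hom_bracket phi D D'; rewrite !phiS.
constructor.
apply: (@CEDGAStructure _ _ X L Omega A (exterior_commutative A_ext) dA
  (@DGAHom _ _ X Omega B psi psi_d)) => U f /=.
by rewrite d_fun psi_fun.
Qed.
End AlgebroidToDifferential.

(** * From a differential to a Lie algebroid *)

Section DifferentialToAlgebroid.
Context {K : fieldType} {KO : set (set K)} {X : ringed_space KO}.
Implicit Types (U V W : opens X).
Hypothesis K0 : [pchar K] =i pred0.
Variables (L : lie_algebroid (X := X)) (E : module_sheaf X).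
Hypotheses (L_free : locally_free_finite L) (E_free : locally_free_finite E).
Variables (Omega : CE_algebra L) (A : galgebra (X := X)).
Variable j : sheaf_hom (dual E) (A 1%N).
Hypothesis A_ext : is_exterior_algebra j.

(** * The anchor defined by a differential *)

Section Anchor.
Variable con : forall k U, E U -> A k.+1 U -> A k U.
Hypothesis conP : is_contraction j (@con).
Variable d : differential A.
Let dP := differential_odd d.
Local Notation rho := (rho con d).

Lemma rho_linearr U (D : E U) c f g :
  rho D (Ocst U c * f + g) = Ocst U c * rho D f + rho D g.
Proof.
by rewrite /rho scalerDl -scalerA dfun_linear (con_linearr conP) gcoef_linear.
Qed.

Lemma rhoM U (D : E U) f g : rho D (f * g) = f * rho D g + g * rho D f.
Proof.
rewrite /rho -scalerA (oderZ dP) gmulZr (gmul_irr (add1n 0) (addn0 1)) gmulr1 addrC.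
by rewrite (con_linearr conP) (conZr conP) gcoef_linear gcoefZ.
Qed.

Lemma rhoD U (D : E U) f g : rho D (f + g) = rho D f + rho D g.
Proof. by have := rho_linearr D 1 f g; rewrite Ocst1 !mul1r. Qed.

Lemma rho_res U V (h : V `<=` U) (D : E U) f : Ores h (rho D f) = rho (res h D) (Ores h f).
Proof. by rewrite /rho gcoef_res (con_res conP) dfun_res resZ gone_res. Qed.

Lemma rho_linearl U f (D D' : E U) g : rho (f *: D + D') g = f * rho D g + rho D' g.
Proof. by rewrite /rho (con_linearl conP) gcoef_linear. Qed.

Definition rho_derivation U (D : E U) : derivation U :=
  @Derivation _ _ X U (fun V h f => rho (res h D) f)
    (fun V h => rho_linearr (res h D)) (fun V h => @rhoM V (res h D))
    (fun V W h k l f => etrans (rho_res k (res h D) f)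
       (congr1 (fun D' => rho D' (Ores k f)) (res_comp h k l D))).

Program Definition rho_anchor : sheaf_hom E tangent :=
  @SheafHom _ _ X E tangent rho_derivation _ _.
Next Obligation.
by move=> U f D D'; apply: der_ext => V h g /=; rewrite res_linear rho_linearl.
Qed.
Next Obligation.
move=> U V h D; apply: der_ext => W k f /=.
by rewrite (res_comp _ _ (subset_trans k h)).
Qed.

Lemma rho_anchor_act U (D : E U) f : der_app (rho_anchor U D) f = rho D f.
Proof. by rewrite /der_app /= res_id. Qed.
End Anchor.

Lemma algebroid_of_ce_dga :
  CE_dga_structure Omega A -> inhabited (lie_algebroid_over L E).
Proof.
case=> A_comm d psi d_fun.
have [con conP] := contraction_exists A_ext.
have [conO conOP] := contraction_exists (ce_exterior Omega).
have dP := differential_odd d.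
pose r := rho con d.
(* phi D is the section of L representing the functional a |-> i_D psi(a) on L^*, by reflexivity of
   L. *)
have phi_ex U (D : E U) : exists s : L U, forall V (h : V `<=` U) a,
    gcoef (con _ _ (res h D) (psi 1%N V (ce_gen Omega V a))) = pairing a (res h s).
  apply: (bidual_surjective L_free (l := fun V h a =>
    gcoef (con _ _ (res h D) (psi 1%N V (ce_gen Omega V a))))) => [V h f a b|V W h k l a].
    by rewrite !shom_linear (con_linearr conP) gcoef_linear.
  by rewrite gcoef_res (con_res conP) !shom_res (res_comp _ _ l).
pose phi U D := projT1 (cid (phi_ex U D)).
have phiE U D : forall V (h : V `<=` U) a,
    gcoef (con _ _ (res h D) (psi 1%N V (ce_gen Omega V a))) = pairing a (res h (phi U D)).
  exact: projT2 (cid (phi_ex U D)).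
have phi_gen U D a :
    con _ _ D (psi 1%N U (ce_gen Omega U a)) = pairing a (phi U D) *: gone A U.
  by rewrite [LHS]gcoefE -{1}(res_id (@subset_refl _ U) D) phiE res_id.
have phi_res U V (h : V `<=` U) D : res h (phi U D) = phi V (res h D).
  apply: (dual_separated L_free) => W k a.
  by rewrite (res_comp _ _ (subset_trans k h)) -!phiE (res_comp _ _ (subset_trans k h)).
have phi_lin U f D D' : phi U (f *: D + D') = f *: phi U D + phi U D'.
  apply: (dual_separated L_free) => W k a.
  by rewrite !res_linear pairing_linearr -!phiE res_linear (con_linearl conP) gcoef_linear.
have con_psi := con_morphism (ce_exterior Omega) conP conOP phi_res phi_gen.
(* Cartan's formula for (ds)(D, D') solved for <s, [D, D']>. It is O_X-linear in s, as the
   derivatives of f from the anchor cancel those from d(f s), so reflexivity of E yields the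
   bracket. *)
pose form U (s : dual E U) D D' : OX U :=
  r U D (pairing s D') - r U D' (pairing s D)
  - gcoef (con _ _ D' (con _ _ D (d _ _ (j U s)))).
have form_lin U f s t D D' :
    form U (f *: s + t) D D' = f * form U s D D' + form U t D D'.
  rewrite /form !pairing_linearl /r !(rhoD conP) !(rhoM conP) shom_linear.
  rewrite (oder_linear dP) !(conDr conP) !(conZr conP) (conM1 conP) gmul0E gmulE0.
  rewrite (conBr conP) !(conZr conP) !(con_gen conP) gcoefK.
  rewrite !gcoefD gcoefN gcoefZ gcoefK !gcoefZ /rho.
  by ring.
have form_res U V (h : V `<=` U) s D D' :
    Ores h (form U s D D') = form V (res h s) (res h D) (res h D').
  have OresB (f g : OX U) : Ores h (f - g) = Ores h f - Ores h g by apply: O_ext.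
  rewrite /form !OresB /r !(rho_res conP) !pairing_res gcoef_res !(con_res conP).
  by rewrite dfun_res shom_res.
have br_ex U (D D' : E U) : exists B : E U, forall V (h : V `<=` U) s,
    form V s (res h D) (res h D') = pairing s (res h B).
  apply: (bidual_surjective E_free (l := fun V h s =>
    form V s (res h D) (res h D'))) => [V h f a b|V W h k l a]; first exact: form_lin.
  by rewrite form_res !(res_comp _ _ l).
pose br U D D' := projT1 (cid (br_ex U D D')).
have brE' U D D' : forall V (h : V `<=` U) s,
    form V s (res h D) (res h D') = pairing s (res h (br U D D')).
  exact: projT2 (cid (br_ex U D D')).
have brE U D D' s : pairing s (br U D D') = form U s D D'.
  by have := brE' U D D' U (@subset_refl _ U) s; rewrite !res_id.
have br_res U V (h : V `<=` U) (D D' : E U) :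
    res h (br U D D') = br V (res h D) (res h D').
  apply: (dual_separated E_free) => W k s.
  rewrite (res_comp _ _ (subset_trans k h)) -!brE'.
  by rewrite !(res_comp _ _ (subset_trans k h)).
have br_eq U (B B' : E U) : (forall V (h : V `<=` U) s,
    pairing s (res h B) = pairing s (res h B')) -> B = B'.
  exact: (dual_separated E_free).
have br_anti U (D D' : E U) : br U D D' = - br U D' D.
  apply: br_eq => V h s; rewrite resN -scaleN1r pairingZr !br_res !brE /form.
  rewrite (con_anti A_ext conP E_free K0).
  by rewrite gcoefN; ring.
have br_gen U (D D' : E U) s :
    con _ _ D' (lie con d D (j U s)) + con _ _ (br U D D') (j U s) =
    lie con d D (con _ _ D' (j U s)).
  rewrite /= (conDr conP) !(con_gen conP) !(con_d_fun con d) brE /form.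
  rewrite [con _ _ D' _]gcoefE -!scalerDl gcoefK; congr (_ *: _).
  by rewrite /r; ring.
have dd_fun U (a : A 0%N U) : d _ _ (d _ _ a) = 0 by apply: dfun_dfun.
have br_linl U (c : K) (s t u : E U) :
    br U (Ocst U c *: s + t) u = Ocst U c *: br U s u + br U t u.
  apply: br_eq => V h a; rewrite resD resZ pairing_linearr !br_res !brE /form.
  rewrite resD resZ Ores_cst !(con_linearl conP) (con_linearr conP) gcoef_linear.
  rewrite pairing_linearr /r (rho_linearl conP) (rho_linearr conP).
  by ring.
have br_linr U (c : K) (s t u : E U) :
    br U s (Ocst U c *: t + u) = Ocst U c *: br U s t + br U s u.
  by rewrite br_anti br_linl opprD -scalerN -!br_anti.
have br_xx U (s : E U) : br U s s = 0.
  apply: br_eq => V h a; rewrite res0 br_res brE /form subrr.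
  rewrite (con_con A_ext conP E_free K0) sub0r -(scale0r (gone A V)) gcoefK oppr0.
  by rewrite [RHS]hom0.
have br_leibniz U f (s t : E U) : br U s (f *: t) =
    f *: br U s t + der_app (rho_anchor conP d U s) f *: t.
  apply: br_eq => V h a; rewrite resD !resZ pairing_linearr pairingZr !br_res !brE.
  rewrite rho_anchor_act (rho_res conP) /form resZ pairingZr /r (rhoM conP).
  rewrite (conZl conP) gcoefZ /rho (conZl conP) gcoefZ.
  by ring.
have br_Nr U (s t : E U) : br U s (- t) = - br U s t.
  have br0 : br U s 0 = 0.
    apply: (addrI (br U s 0)); have := br_linr U 1 s 0 0.
    by rewrite Ocst1 !scale1r !addr0.
  apply: (addrI (br U s t)); have := br_linr U 1 s t (- t).
  by rewrite Ocst1 !scale1r !subrr br0.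
(* By [con3_dd], pairing the Jacobiator with a form gives the triple contraction of d^2 of that
   form, which is 0. *)
have br_jacobi' U (s t u : E U) :
    br U t (br U s u) - br U s (br U t u) + br U (br U s t) u = 0.
  apply: br_eq => V h a; rewrite res0 !resD resN !br_res [RHS]hom0.
  have := con3_dd A_ext conP dP br_res br_gen dd_fun (res h s) (res h t) (res h u) (j V a).
  rewrite dfun_dfun !(con0r conP) (con_gen conP) => e.
  by apply: (gone_inj (A := A)); rewrite scale0r -e.
have br_jacobi U (s t u : E U) :
    br U s (br U t u) + br U t (br U u s) + br U u (br U s t) = 0.
  rewrite [br U u s]br_anti br_Nr [br U u _]br_anti; apply: oppr_inj.
  rewrite oppr0 -(br_jacobi' U s t u) !opprD !opprK; congr (_ + _).
  exact: addrC.
have br_anchor U (s t : E U) : rho_anchor conP d U (br U s t) =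
    der_bracket (rho_anchor conP d U s) (rho_anchor conP d U t).
  apply: der_ext => V h f /=; rewrite br_res.
  have := lie_bracket_fun A_ext conP dP br_res br_gen dd_fun
    (res h s) (res h t) (f *: gone A V).
  rewrite !(lie_fun con d) -scalerBl.
  exact: gone_inj.
pose S : lie_algebroid_on E := @LieAlgebroidOn _ _ X E br (rho_anchor conP d)
  br_linl br_linr br_xx br_jacobi br_res br_anchor br_leibniz.
pose phi_hom : sheaf_hom E L := @SheafHom _ _ X E L phi phi_lin phi_res.
(* This contracts with s the condition that df is psi_1 of the transposed anchor of L applied to d_X
   f. *)
have phi_act U (s : E U) f : der_app (anchor L U (phi U s)) f = rho con d s f.
  apply: (gone_inj (A := A)); rewrite -(con_d_fun con d) d_fun phi_gen; congr (_ *: _).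
  have := pairing_d_X L f (@subset_refl _ U) (phi U s).
  by rewrite Ores_id res_id => <-.
have phi_anchor U (s : E U) : anchor L U (phi U s) = rho_anchor conP d U s.
  apply: der_ext => V h f /=; rewrite -phi_act -phi_res -shom_res /der_app /=.
  by congr (der_fun _ _ _); apply: Prop_irrelevance.
have phi_br U (s t : E U) : phi U (br U s t) = bracket L (phi U s) (phi U t).
  apply: (dual_separated L_free) => V h a.
  rewrite bracket_res !phi_res br_res; set D := res h s; set D' := res h t.
  (* w is the transpose of phi applied to a; comparing d(psi a) with psi(da) on D and D' leaves the
     equality of the bracket terms, as the anchor terms agree by [phi_act]. *)
  have [w ww] := gen_of_degree1 A_ext conP E_free K0 (psi 1%N V (ce_gen Omega V a)).
  have wE D1 : pairing w D1 = pairing a (phi V D1).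
    by apply: (gone_inj (A := A)); rewrite -phi_gen ww (con_gen conP).
  rewrite -wE brE /form !wE -ww.
  have /= <- := dga_hom_diff psi (ce_gen Omega V a).
  rewrite !con_psi (ce_d_gen K0 L_free conOP) shomZ ghom1 gcoefK !phi_act /r.
  by ring.
constructor.
exact: (@LieAlgebroidOver _ _ X L E S
  (@LieAlgebroidHom _ _ X (LieAlgebroid S) L phi_hom phi_br phi_anchor)).
Qed.
End DifferentialToAlgebroid.

(** Real and complex numbers form numeric fields, and in the algebraic case the characteristic is
    prescribed. Division by k+1 in Euler's identity rests on this. *)
Lemma special_char0 (K : fieldType) (KO : set (set K)) (X : ringed_space KO) :
  special X -> [pchar K] =i pred0.
Proof.
case=> [R Y _|R Y _|R Y _|F Y F0 _] //.
- exact: (Num.Theory.pchar_num R).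
- exact: (Num.Theory.pchar_num (complex R)).
- exact: (Num.Theory.pchar_num (complex R)).
Qed.

End LieAlgebroids.

Theorem theorem4p3 (K : fieldType) (KO : set (set K)) (X : ringed_space KO)
    (X_special : special X)
    (L : lie_algebroid (X := X)) (L_free : locally_free_finite L)
    (E : module_sheaf X) (E_free : locally_free_finite E)
    (Omega : CE_algebra L)
    (A : galgebra (X := X)) (j : sheaf_hom (dual E) (A 1))
    (A_ext : is_exterior_algebra j) :
  inhabited (lie_algebroid_over L E) <-> inhabited (CE_dga_structure Omega A).
Proof.
have K0 := special_char0 X_special; split=> -[].
  exact: (ce_dga_of_algebroid K0 L_free E_free Omega A_ext).
exact: (algebroid_of_ce_dga K0 L_free E_free A_ext).
Qed.
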